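(* Let $\widetilde{p} \in C^{1}(\Omega)\cap C^{0}(\overline{\Omega})$ be (the pressure component of) a solution $(\widetilde{p},\mathbf{v})$ of the boundary value problem (Barus model with conservative body force) $$\widetilde{\mu}_0(\mathbf{x})\, g(\widetilde{p}(\mathbf{x}))\,\mathbf{K}^{-1}(\mathbf{x})\,\mathbf{v}(\mathbf{x}) + \mathrm{grad}[\widetilde{p}(\mathbf{x})] = \mathbf{0} \ \text{in } \Omega,\qquad \mathrm{div}[\mathbf{v}(\mathbf{x})]=0 \ \text{in } \Omega,$$ $$\widetilde{p}(\mathbf{x})=\widetilde{p}_{\mathrm{p}}(\mathbf{x})\ \text{on } \Gamma^{p},\qquad \mathbf{v}(\mathbf{x})\cdot\widehat{\mathbf{n}}(\mathbf{x}) = v_n(\mathbf{x})\ \text{on } \Gamma^{v}.$$ If $v_n(\mathbf{x})\le 0$ on $\Gamma^{v}$, then $$\min_{\mathbf{y}\in\Gamma^{p}}\big[\widetilde{p}_{\mathrm{p}}(\mathbf{y})\big]\le \widetilde{p}(\mathbf{x})\qquad \forall\,\mathbf{x}\in\overline{\Omega}.$$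
   Context: $\Omega\subset\mathbb{R}^{nd}$ is a bounded Lipschitz domain (open and connected) with boundary $\partial\Omega=\overline{\Omega}\setminus\Omega$ and unit outward normal $\widehat{\mathbf{n}}$. The boundary is partitioned as $\Gamma^{p}\cup\Gamma^{v}=\partial\Omega$, $\Gamma^{p}\cap\Gamma^{v}=\emptyset$, with $\Gamma^{p}\neq\emptyset$. Minima over $\Gamma^{p}$ are read as infima if not attained. The permeability $\mathbf{K}(\mathbf{x})$ is a symmetric tensor field for which there are constants $0<k_1\le k_2$ with $k_1\,\boldsymbol{\zeta}\cdot\boldsymbol{\zeta}\le \boldsymbol{\zeta}\cdot\mathbf{K}(\mathbf{x})\boldsymbol{\zeta}\le k_2\,\boldsymbol{\zeta}\cdot\boldsymbol{\zeta}$ for all $\mathbf{x}\in\Omega$ and all $\boldsymbol{\zeta}\in\mathbb{R}^{nd}\setminus\{\mathbf 0\}$. Constants: $\mu_0>0$ (reference viscosity), $p_0>0$ (reference pressure), $\beta\ge 0$. The body force is conservative, $\rho\mathbf{b}=-\mathrm{grad}[\xi]$ for a given scalar field $\xi$, and $\widetilde{p}=p+\xi$ is the modified pressure ($p$ being the pressure). Define $$\widetilde{\mu}_0(\mathbf{x})=\mu_0\exp\!\left[-\frac{\beta\,\xi(\mathbf{x})}{p_0}\right]>0,\qquad g(s)=\exp\!\left[\beta\left(\frac{s}{p_0}-1\right)\right].$$ The boundary value problem is understood in the weak sense: $\widetilde{p}\in H^1(\Omega)\cap C^1(\Omega)\cap C^0(\overline{\Omega})$, $\widetilde{p}=\widetilde{p}_{\mathrm{p}}$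 on $\Gamma^{p}$, $\mathbf{v}=-\frac{1}{\widetilde{\mu}_0\,g(\widetilde{p})}\mathbf{K}\,\mathrm{grad}[\widetilde{p}]$ in $\Omega$, and $\int_{\Omega}\mathrm{grad}[w]\cdot\mathbf{v}\,\mathrm{d}\Omega=\int_{\Gamma^{v}}w\,v_n\,\mathrm{d}\Gamma$ for all $w\in H^1(\Omega)$ with zero trace on $\Gamma^{p}$. The prescribed data $v_n$ is a function on $\Gamma^{v}$ for which the boundary integral is well defined. *)

(* Defs.v *)
From HB Require Import structures.
From mathcomp Require Import all_boot all_order all_algebra.
From mathcomp Require Import all_classical all_reals all_analysis.
Export numFieldNormedType.Exports.

Set Implicit Arguments.
Unset Strict Implicit.
Unset Printing Implicit Defensive.

Import Order.TTheory GRing.Theory Num.Theory.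

Local Open Scope classical_set_scope.
Local Open Scope ring_scope.

(* Points and vectors of R^n are row vectors 'rV[R]_n.  The norm that the
   library puts on them is the sup norm: it is used only through the topology.
   Lengths are measured with the Euclidean norm [enorm]. *)

Section Euclidean.
Context {R : realType} {n : nat}.

Definition dotv (x y : 'rV[R]_n) : R := \sum_(i < n) x ord0 i * y ord0 i.

Definition enorm (x : 'rV[R]_n) : R := Num.sqrt (dotv x x).

(* Row-vector form of the column vector A z. *)
Definition mulmxv (A : 'M[R]_n) (z : 'rV[R]_n) : 'rV[R]_n := z *m A^T.

End Euclidean.

(* The sigma-algebra generated by the coordinates, as for [n.-tuple T] in the
   library; for T = R it is the Borel sigma-algebra of R^n. *)

Section RowMeasurable.
Context {d : measure_display} {T : measurableType d}.
Variable n : nat.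

Let coors : 'I_n -> 'rV[T]_n -> T := fun i x => x ord0 i.

Let rV_set0 : g_sigma_preimage coors set0.
Proof. exact: sigma_algebra0. Qed.

Let rV_setC A : g_sigma_preimage coors A -> g_sigma_preimage coors (~` A).
Proof. exact: sigma_algebraC. Qed.

Let rV_bigcup (F : (set 'rV[T]_n)^nat) :
  (forall i, g_sigma_preimage coors (F i)) ->
  g_sigma_preimage coors (\bigcup_i (F i)).
Proof. exact: sigma_algebra_bigcup. Qed.

HB.instance Definition _ := @isMeasurable.Build (measure_tuple_display d)
  'rV[T]_n (g_sigma_preimage coors) rV_set0 rV_setC rV_bigcup.

End RowMeasurable.

Lemma measurable_coord d (T : measurableType d) n (i : 'I_n) :
  measurable_fun [set: 'rV[T]_n] (fun x : 'rV[T]_n => x ord0 i).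
Proof.
move=> _ Y mY; rewrite setTI; apply: sub_sigma_algebra => /=.
rewrite -bigcup_seq/=; exists i => /=; first by rewrite mem_index_enum.
by exists Y => //; rewrite setTI.
Qed.

Lemma measurable_fun_rVP d1 d2 (T1 : measurableType d1)
    (T2 : measurableType d2) n (f : T1 -> 'rV[T2]_n) :
  (forall i, measurable_fun [set: T1] (fun x => f x ord0 i)) ->
  measurable_fun [set: T1] f.
Proof.
move=> mf; suff fS : g_sigma_preimage (fun i x => f x ord0 i) `<=` measurable.
  move=> _ A mA; apply: fS.
  rewrite (g_sigma_preimage_comp (fun i (x : 'rV[T2]_n) => x ord0 i) f).
  by exists A.
apply: smallest_sub; first exact: sigma_algebra_measurable.
case: n => [|n] in f mf *; first by rewrite big_ord0.
rewrite -bigcup_mkord_ord; apply: bigcup_sub => i Ii.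
by move=> A [B mB <-]; exact: mf.
Qed.

Section Lebesgue.
Context {R : realType}.

Definition consrV n (z : R * 'rV[R]_n) : 'rV[R]_n.+1 :=
  \row_(i < n.+1) if unlift ord0 i is Some j then z.2 ord0 j else z.1.

Definition unconsrV n (x : 'rV[R]_n.+1) : R * 'rV[R]_n :=
  (x ord0 ord0, \row_(j < n) x ord0 (lift ord0 j)).

Lemma consrVK n : cancel (@consrV n) (@unconsrV n).
Proof.
move=> [a y]; rewrite /unconsrV /consrV mxE unlift_none/=; congr pair.
by apply/rowP => j; rewrite !mxE liftK.
Qed.

Lemma measurable_consrV n : measurable_fun [set: R * 'rV[R]_n] (@consrV n).
Proof.
apply: measurable_fun_rVP => i; rewrite /consrV.
under eq_fun do rewrite mxE.
case: unliftP => [j _|_]; last exact: measurable_fst.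
exact: (measurableT_comp (f := fun y : 'rV[R]_n => y ord0 j)
  (measurable_coord j) measurable_snd).
Qed.

Lemma measurable_unconsrV n : measurable_fun [set: 'rV[R]_n.+1] (@unconsrV n).
Proof.
apply: measurable_fun_pair; first exact: measurable_coord.
apply: measurable_fun_rVP => i.
by under eq_fun do rewrite mxE; exact: measurable_coord.
Qed.

Section Step.
Variables (n : nat) (m : {sigma_finite_measure set 'rV[R]_n -> \bar R}).

Definition leb_succ : set 'rV[R]_n.+1 -> \bar R :=
  pushforward (@lebesgue_measure R \x m)%E (@consrV n).

Let leb_succ0 : leb_succ set0 = 0%E.
Proof. by rewrite /leb_succ /pushforward preimage_set0 measure0. Qed.

Let leb_succ_ge0 A : (0 <= leb_succ A)%E.
Proof. by rewrite /leb_succ /pushforward; apply: measure_ge0. Qed.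

Let leb_succ_sigma_additive : semi_sigma_additive leb_succ.
Proof.
have mP A : measurable A -> measurable (@consrV n @^-1` A).
  by move=> mA; rewrite -[X in measurable X]setTI; exact: measurable_consrV.
move=> F mF tF mUF; rewrite /leb_succ /pushforward preimage_bigcup.
apply: measure_semi_sigma_additive.
- by move=> k; exact: mP.
- apply/trivIsetP => /= i j _ _ ij; rewrite -preimage_setI.
  by move/trivIsetP : tF => /(_ _ _ _ _ ij) ->//; rewrite preimage_set0.
- by rewrite -preimage_bigcup; exact: mP.
Qed.

HB.instance Definition _ := isMeasure.Build _ _ _ leb_succ
  leb_succ0 leb_succ_ge0 leb_succ_sigma_additive.

Let leb_succ_sigma_finite : sigma_finite setT leb_succ.
Proof.
have /sigma_finiteP[F [TF ndF Foo]] := sigma_finiteT (@lebesgue_measure R).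
have /sigma_finiteP[G [TG ndG Goo]] := sigma_finiteT m.
exists (fun k => @unconsrV n @^-1` (F k `*` G k)).
  rewrite -preimage_bigcup (_ : \bigcup_k _ = setT) ?preimage_setT//.
  rewrite -setXTT TF TG predeqE => -[x y]; split.
    by move=> [k _ []/= ? ?]; split; exists k.
  move=> [/= [i _ Fix] [k _ Gky]]; exists (maxn i k) => //; split.
  - by move: x Fix; exact/subsetPset/ndF/leq_maxl.
  - by move: y Gky; exact/subsetPset/ndG/leq_maxr.
move=> k; have [mF Fk] := Foo k; have [mG Gk] := Goo k; split.
  rewrite -[X in measurable X]setTI; apply: measurable_unconsrV => //.
  exact: measurableX.
rewrite /leb_succ /pushforward (_ : _ @^-1` _ = F k `*` G k).
  by rewrite product_measure1E// lte_mul_pinfty// ge0_fin_numE.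
by rewrite -comp_preimage (_ : _ \o _ = id)//; apply/funext/consrVK.
Qed.

HB.instance Definition _ := Measure_isSigmaFinite.Build _ _ _ leb_succ
  leb_succ_sigma_finite.

End Step.

(* n-dimensional Lebesgue measure: the n-fold product of the Lebesgue measure
   of R, transported to row vectors (a unit mass at the point of R^0). *)
Fixpoint leb n : {sigma_finite_measure set 'rV[R]_n -> \bar R} :=
  match n with
  | 0 => @dirac _ 'rV[R]_0 0 R
  | n'.+1 => leb_succ (leb n')
  end.

End Lebesgue.

(* Every subset of T is measurable: [mu_ext] over this type is the outer measure
   obtained from coverings by arbitrary sets. *)
Definition powerset_type (T : Type) : Type := T.

HB.instance Definition _ (T : pointedType) := Pointed.on (powerset_type T).
HB.instance Definition _ (T : pointedType) :=
  @isMeasurable.Build default_measure_display (powerset_type T)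
    [set: set T] I (fun _ _ => I) (fun _ _ => I).

Section Hausdorff.
Context {R : realType} {n : nat}.

Definition ediam (A : set 'rV[R]_n) : R :=
  sup [set r | exists x y, [/\ A x, A y & r = enorm (x - y)]].

Definition unit_ball (s : nat) : set 'rV[R]_s := [set y | enorm y <= 1].

(* Volume of the s-dimensional ball of diameter diam A. *)
Definition gauge (s : nat) (A : set 'rV[R]_n) : \bar R :=
  if A == set0 then 0%E else
  (leb s (@unit_ball s) * ((ediam A / 2) ^+ s)%:E)%E.

(* The value +oo restricts the coverings to sets of diameter at most e. *)
Definition gauge_upto (s : nat) (e : R) (A : set (powerset_type 'rV[R]_n)) :
    \bar R :=
  if `[< forall x y : 'rV[R]_n, A x -> A y -> enorm (x - y) <= e >]
  then gauge s A else +oo%E.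

(* s-dimensional Hausdorff outer measure, normalised to agree with Lebesgue
   measure: for s = n - 1 it is the surface measure on hypersurfaces of R^n. *)
Definition hausdorff (s : nat) (A : set 'rV[R]_n) : \bar R :=
  ereal_sup [set mu_ext (gauge_upto s e) A | e in [set e : R | 0 < e]].

Lemma gauge_ge0 s A : (0 <= gauge s A)%E.
Proof.
rewrite /gauge; case: ifPn => // _; apply: mule_ge0 => //.
rewrite lee_fin exprn_ge0// divr_ge0//.
rewrite /ediam; set E := [set _ | _].
have [[[r Er] hE]|/sup_out ->//] := pselect (has_sup E).
apply: le_trans (ub_le_sup hE Er).
by case: Er => x [y [_ _ ->]]; exact: sqrtr_ge0.
Qed.

Lemma gauge_upto_ge0 s e A : (0 <= gauge_upto s e A)%E.
Proof. by rewrite /gauge_upto; case: ifPn => // _; exact: gauge_ge0. Qed.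

Lemma gauge_upto0 s e : gauge_upto s e set0 = 0%E.
Proof.
rewrite /gauge_upto ifT; last by apply/asboolP => x y [].
by rewrite /gauge eqxx.
Qed.

Let hausdorff0 s : hausdorff s set0 = 0%E.
Proof.
rewrite /hausdorff (_ : [set _ | _ in _] = [set 0%E]) ?ereal_sup1//.
apply/seteqP; split=> [_ [e _ <-]|_ ->] /=.
  exact: (mu_ext0 (gauge_upto0 s e) (gauge_upto_ge0 s e)).
exists 1; first exact: ltr01.
exact: (mu_ext0 (gauge_upto0 s 1) (gauge_upto_ge0 s 1)).
Qed.

Let hausdorff_ge0 s A : (0 <= hausdorff s A)%E.
Proof.
apply: (@le_trans _ _ (mu_ext (gauge_upto s 1) A)).
  exact: (mu_ext_ge0 (gauge_upto_ge0 s 1)).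
by apply: ereal_sup_ubound; exists 1 => //; exact: ltr01.
Qed.

Let le_hausdorff s : {homo hausdorff s : A B / A `<=` B >-> (A <= B)%E}.
Proof.
move=> A B AB; apply: ge_ereal_sup => _ [e e0 <-].
apply: (@le_trans _ _ (mu_ext (gauge_upto s e) B)); first exact: le_mu_ext.
by apply: ereal_sup_ubound; exists e.
Qed.

Let hausdorff_sigma_subadditive s : sigma_subadditive (hausdorff s).
Proof.
move=> F; apply: ge_ereal_sup => _ [e e0 <-].
apply: (le_trans (mu_ext_sigma_subadditive (gauge_upto_ge0 s e) F)).
apply: lee_nneseries => [k _ _|k _].
  exact: (mu_ext_ge0 (gauge_upto_ge0 s e)).
by apply: ereal_sup_ubound; exists e.
Qed.

HB.instance Definition _ s := isOuterMeasure.Build R 'rV[R]_n (hausdorff s)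
  (hausdorff0 s) (hausdorff_ge0 s) (@le_hausdorff s)
  (@hausdorff_sigma_subadditive s).

End Hausdorff.

Section Surface.
Context {R : realType}.

(* R^(n+1) with the sigma-algebra of the sets that are measurable, in the sense
   of Caratheodory, for the n-dimensional Hausdorff measure. *)
Definition surf_type (n : nat) :=
  caratheodory_type (@hausdorff R n.+1 n).

Definition surf (n : nat) : set (surf_type n) -> \bar R :=
  @hausdorff R n.+1 n.

HB.instance Definition _ n := Measurable.on (surf_type n).

Let surf0 n : @surf n set0 = 0%E.
Proof. exact: outer_measure0. Qed.

Let surf_ge0 n A : (0 <= @surf n A)%E.
Proof. exact: outer_measure_ge0. Qed.

Let surf_sigma_additive n : semi_sigma_additive (@surf n).
Proof. by move=> F mF tF mUF; exact: caratheodory_measure_sigma_additive. Qed.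

HB.instance Definition _ n := isMeasure.Build _ _ _ (@surf n)
  (@surf0 n) (@surf_ge0 n) (@surf_sigma_additive n).

Definition boundary n (Om : set 'rV[R]_n) : set 'rV[R]_n :=
  closure Om `\` Om.

(* Near each boundary point, in suitable orthonormal coordinates, Om is the
   region above the graph of a Lipschitz function of the first n coordinates. *)
Definition lipschitz_boundary n (Om : set 'rV[R]_n.+1) : Prop :=
  forall x0, boundary Om x0 ->
  exists (r L : R) (Q : 'M[R]_n.+1) (phi : 'rV[R]_n -> R),
    [/\ 0 < r, Q *m Q^T = 1%:M,
        forall a b, `|phi a - phi b| <= L * enorm (a - b) &
        forall x, enorm (x - x0) < r ->
          let y := (x - x0) *m Q in
          Om x <-> phi (col' ord_max y) < y ord0 ord_max].

Definition lipschitz_domain n (Om : set 'rV[R]_n.+1) : Prop :=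
  [/\ open Om, connected Om, bounded_set Om & lipschitz_boundary Om].

End Surface.

Arguments surf {R} n _.

Section Calculus.
Context {R : realType} {n : nat}.
Implicit Types (f : 'rV[R]_n -> R) (Om : set 'rV[R]_n).

Definition partial (i : 'I_n) f (x : 'rV[R]_n) : R :=
  'D_(delta_mx ord0 i) f x.

Definition grad f (x : 'rV[R]_n) : 'rV[R]_n := \row_(i < n) partial i f x.

Definition C1_on Om f : Prop :=
  forall x, Om x -> forall i : 'I_n,
    derivable f x (delta_mx ord0 i) /\ {for x, continuous (partial i f)}.

Fixpoint Ck (k : nat) f : Prop :=
  match k with
  | 0 => continuous f
  | k'.+1 => continuous f /\ forall i : 'I_n,
      (forall x, derivable f x (delta_mx ord0 i)) /\ Ck k' (partial i f)
  end.

Definition test_function Om f : Prop :=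
  let supp := closure [set x | f x != 0] in
  [/\ forall k, Ck k f, compact supp & supp `<=` Om].

End Calculus.

Definition square_integrable d (T : measurableType d) (R : realType)
    (mu : set T -> \bar R) (D : set T) (f : T -> R) : Prop :=
  measurable_fun D f /\ (\int[mu]_(x in D) ((f x) ^+ 2)%:E < +oo)%E.

Section Sobolev.
Context {R : realType} {n : nat}.
Implicit Types (Om : set 'rV[R]_n.+1) (w : 'rV[R]_n.+1 -> R).
Implicit Types (G : 'rV[R]_n.+1 -> 'rV[R]_n.+1).

Definition weak_grad Om w G : Prop :=
  forall phi, test_function Om phi -> forall i : 'I_n.+1,
    \int[leb n.+1]_(x in Om) (w x * partial i phi x) =
    - \int[leb n.+1]_(x in Om) (G x ord0 i * phi x).

(* w is in H^1(Om), with weak gradient G. *)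
Definition H1 Om w G : Prop :=
  [/\ square_integrable (leb n.+1) Om w,
      forall i : 'I_n.+1, square_integrable (leb n.+1) Om (fun x => G x ord0 i)
    & weak_grad Om w G].

(* h is the trace on the boundary of w in H^1(Om): the trace operator is the
   continuous extension, from H^1(Om) to L^2 of the boundary, of the restriction
   to the boundary of the functions in H^1(Om) that are continuous up to it. *)
Definition is_trace Om w G (h : 'rV[R]_n.+1 -> R) : Prop :=
  measurable_fun (boundary Om : set (@surf_type R n)) (h : @surf_type R n -> R) /\
  exists (wk : nat -> 'rV[R]_n.+1 -> R) (Gk : nat -> 'rV[R]_n.+1 -> 'rV[R]_n.+1),
  [/\ forall k, H1 Om (wk k) (Gk k) /\ {within closure Om, continuous (wk k)},
      (fun k => \int[leb n.+1]_(x in Om) ((wk k x - w x) ^+ 2)%:E)%E @ \oo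
        --> 0%E,
      forall i : 'I_n.+1,
        (fun k => \int[leb n.+1]_(x in Om)
          ((Gk k x ord0 i - G x ord0 i) ^+ 2)%:E)%E @ \oo --> 0%E &
      (fun k => \int[surf n]_(x in boundary Om)
        ((wk k x - h x) ^+ 2)%:E)%E @ \oo --> 0%E].

(* w in H^1(Om), with weak gradient G and trace h, and zero trace on Gp. *)
Definition admissible Om (Gp : set 'rV[R]_n.+1) w G h : Prop :=
  [/\ H1 Om w G, is_trace Om w G h &
      {ae surf n, forall x, Gp x -> h x = 0}].

End Sobolev.

Section BoundaryValueProblem.
Context {R : realType} {n : nat}.
Notation point := 'rV[R]_n.+1.

Definition modified_viscosity (mu0 p0 beta : R) (xi : point -> R) (x : point) :
  R := mu0 * expR (- (beta * xi x / p0)).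

Definition barus_factor (p0 beta s : R) : R := expR (beta * (s / p0 - 1)).

(* The integral of (trace of w) * vn over Gv exists for every test function w. *)
Definition flux_data (Om Gp Gv : set point) (vn : point -> R) : Prop :=
  forall w G h, admissible Om Gp w G h ->
    (@surf R n).-integrable (Gv : set (@surf_type R n))
      (fun x => (h x * vn x)%:E).

(* Both div v = 0 in Om and v.n = vn on Gv are contained in [weak_balance].  Its
   right-hand side is finite by [flux_data], hence so is its left-hand side. *)
Record weak_solution (Om Gp Gv : set point) (K : point -> 'M[R]_n.+1)
    (visc : point -> R) (g : R -> R) (pp vn : point -> R)
    (p : point -> R) (v : point -> point) : Prop := WeakSolution {
  weak_H1 : exists G, H1 Om p G;
  weak_C1 : C1_on Om p;
  weak_C0 : {within closure Om, continuous p};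
  weak_dirichlet : forall x, Gp x -> p x = pp x;
  weak_darcy : forall x, Om x ->
    v x = - ((visc x * g (p x))^-1 *: mulmxv (K x) (grad p x));
  weak_balance : forall w G h, admissible Om Gp w G h ->
    (\int[leb n.+1]_(x in Om) (dotv (G x) (v x))%:E =
     \int[surf n]_(x in Gv) (h x * vn x)%:E)%E
}.

End BoundaryValueProblem.

(* Main.v *)
Require Import Defs.
From mathcomp Require Import all_boot all_order all_algebra.
From mathcomp Require Import all_classical all_reals all_analysis.
From mathcomp Require Import measurable_realfun.
From mathcomp Require Import ring lra.

(* Let m be the infimum of the Dirichlet data.  Test the weak balance with
   w = phi(p), where phi is smooth, nondecreasing and nonpositive, vanishes on
   [m, +oo[ and has a positive derivative on ]-oo, m[; w vanishes on Gp.  The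
   boundary term is nonnegative because w and vn are both nonpositive, while by
   Darcy's law the interior term is minus the integral of
   phi'(p) (grad p . K grad p) / (visc g(p)).  Both are therefore zero, and
   ellipticity gives grad p = 0 wherever p < m.  If p < m at some point of Om,
   then p is a constant c < m on the connected set Om, hence on its closure,
   contradicting p >= m on the nonempty set Gp.

   For w to be admissible, phi'(p) grad p must be square integrable, whereas
   H1 only provides some weak gradient of p: the two gradients agree almost
   everywhere by integration by parts and the fundamental lemma of the calculus
   of variations.  The trace of w must moreover be measurable for the surface
   measure: the Hausdorff measure is a metric outer measure, so Caratheodory's
   criterion makes closed sets measurable. *)

Set Implicit Arguments.
Unset Strict Implicit.
Unset Printing Implicit Defensive.

Import Order.TTheory GRing.Theory Num.Theory.

Local Open Scope classical_set_scope.
Local Open Scope ring_scope.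

(** * Topology and Lebesgue measure of R^n *)

Section RowTopology.
Context {R : realType} {n : nat}.
Implicit Types (x y a b : 'rV[R]_n) (A : set 'rV[R]_n).

Lemma rV_ballP x y e :
  0 < e -> (ball x e y <-> forall i, `|x ord0 i - y ord0 i| < e).
Proof.
move=> e0; split=> [[_ xy] i|xy]; first exact: xy.
by split=> // i j; rewrite ord1; exact: xy.
Qed.

Lemma coord_norm x i : `|x ord0 i| <= `|x|.
Proof.
rewrite [leRHS]/Num.norm /= mx_normrE; apply/bigmax_geP; right => /=.
by exists (ord0, i).
Qed.

Lemma rV_norm_lt x e : 0 < e -> (forall i, `|x ord0 i| < e) -> `|x| < e.
Proof.
move=> e0 xe; have : ball 0 e (- x).
  by apply/rV_ballP => // i; rewrite !mxE opprK add0r.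
by rewrite mx_norm_ball /ball_/= opprK add0r.
Qed.

Definition obox a b : set 'rV[R]_n :=
  [set x | forall i, a ord0 i < x ord0 i < b ord0 i].

Definition cbox a b : set 'rV[R]_n :=
  [set x | forall i, a ord0 i <= x ord0 i <= b ord0 i].

Lemma sub_obox_cbox a b : obox a b `<=` cbox a b.
Proof. by move=> x abx i; have /andP[/ltW-> /ltW->] := abx i. Qed.

Lemma obox_coordsE a b :
  obox a b = \big[setI/setT]_(i < n)
    ((fun x : 'rV[R]_n => x ord0 i) @^-1` `]a ord0 i, b ord0 i[%classic).
Proof.
apply/seteqP; split => x.
  by move=> abx; rewrite -bigcap_seq => i _ /=; rewrite in_itv/=.
rewrite -bigcap_seq => xab i; have := xab i; rewrite /= in_itv/=; apply.
by rewrite mem_index_enum.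
Qed.

Lemma measurable_obox a b : measurable (obox a b).
Proof.
rewrite obox_coordsE; apply: bigsetI_measurable => i _.
by rewrite -[X in measurable X]setTI; exact: measurable_coord.
Qed.

Lemma open_obox_nbhs A x : open A -> A x ->
  exists2 e : R, 0 < e & forall y, (forall i, `|x ord0 i - y ord0 i| < e) -> A y.
Proof.
move=> /[apply] /= /nbhs_ballP[e /= e0 xeA]; exists e => // y xy.
by apply: xeA; apply/rV_ballP.
Qed.

(** Rational corners leave only countably many boxes, so open sets become countable unions of boxes.
    The closed box is kept inside [A] so that a bump function on the open box is a test function on
    [A]. *)
Lemma open_rat_obox A x : open A -> A x -> exists ab : 'rV[rat]_n * 'rV[rat]_n,
  let a := map_mx ratr ab.1 in let b := map_mx ratr ab.2 in
  obox a b x /\ cbox a b `<=` A.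
Proof.
move=> oA Ax; have [e e0 xeA] := open_obox_nbhs oA Ax.
have /choice[l lP] i : exists q : rat, x ord0 i - e / 2 < ratr q < x ord0 i.
  have [|q] := @rat_in_itvoo _ (x ord0 i - e / 2) (x ord0 i); first lra.
  by rewrite in_itv/= => ?; exists q.
have /choice[u uP] i : exists q : rat, x ord0 i < ratr q < x ord0 i + e / 2.
  have [|q] := @rat_in_itvoo _ (x ord0 i) (x ord0 i + e / 2); first lra.
  by rewrite in_itv/= => ?; exists q.
exists (\row_i l i, \row_i u i) => /=; split.
  by move=> i; rewrite !mxE; move: (lP i) (uP i) => /andP[_ ->] /andP[->].
move=> y By; apply: xeA => i; have := By i; rewrite !mxE.
move: (lP i) (uP i) => /andP[? ?] /andP[? ?] /andP[? ?].
by rewrite ltr_norml; apply/andP; split; lra.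
Qed.

(** The sigma-algebra is generated by the coordinates, not by the topology; the link is that an open
    set is the union of the countably many rational open boxes that it contains. *)
Lemma open_measurable_rV A : open A -> measurable A.
Proof.
move=> oA; pose B (ab : 'rV[rat]_n * 'rV[rat]_n) : set 'rV[R]_n :=
  let B := obox (map_mx ratr ab.1) (map_mx ratr ab.2) in
  if `[< B `<=` A >] then B else set0.
rewrite (_ : A = \bigcup_ab B ab).
  apply: countable_bigcupT_measurable => [|ab]; first exact: countableP.
  by rewrite /B; case: ifPn => // _; exact: measurable_obox.
apply/seteqP; split => [x Ax|x [ab _]]; rewrite /B; last first.
  by case: ifPn => // /asboolP; exact.
have [ab [Bx BA]] := open_rat_obox oA Ax.
by exists ab => //; rewrite ifT//; apply/asboolP => y /sub_obox_cbox/BA.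
Qed.

Lemma open_continuous_measurable A (f : 'rV[R]_n -> R) : open A ->
  (forall x, A x -> {for x, continuous f}) -> measurable_fun A f.
Proof.
move=> oA cf; apply: (measurability _ (RGenOpens.measurableE R)).
move=> _ [_ [a [b ->]] <-]; apply: open_measurable_rV.
rewrite openE => x [Ax] fx; apply: filterI; first exact: open_nbhs_nbhs.
have ofx : open_nbhs (f x) `]a, b[%classic by split=> //; exact: interval_open.
exact: cf _ Ax _ (open_nbhs_nbhs ofx).
Qed.

Lemma continuous_measurable_rV (f : 'rV[R]_n -> R) :
  continuous f -> measurable_fun [set: 'rV[R]_n] f.
Proof.
move=> cf; apply: open_continuous_measurable => [|x _]; first exact: openT.
exact: cf.
Qed.

Lemma compact_cbox a b : compact (cbox a b).
Proof.
rewrite (_ : cbox a b =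
    [set x | forall i, `[a ord0 i, b ord0 i]%classic (x ord0 i)]); last first.
  by apply/seteqP; split => x abx i; have := abx i; rewrite /= in_itv.
apply: (@rV_compact _ _ (fun i => `[a ord0 i, b ord0 i]%classic)) => i.
exact: segment_compact.
Qed.

Lemma closed_cbox a b : closed (cbox a b).
Proof. by apply: compact_closed (@compact_cbox a b); exact: norm_hausdorff. Qed.

End RowTopology.

(** * Lebesgue measure of boxes, bounded sets and open sets *)

Section LebesgueBox.
Context {R : realType}.

Lemma consrV_obox n (a b : 'rV[R]_n.+1) :
  @consrV R n @^-1` obox a b =
  `](unconsrV a).1, (unconsrV b).1[ `*` obox (unconsrV a).2 (unconsrV b).2.
Proof.
apply/seteqP; split => -[t y] /=; rewrite /obox/=.
  move=> aby; split.
    by have := aby ord0; rewrite mxE unlift_none in_itv.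
  by move=> i; have := aby (lift ord0 i); rewrite !mxE liftK.
move=> [+ aby] i; rewrite in_itv/= => abt.
rewrite mxE; case: unliftP => [j ->|->//].
by have := aby j; rewrite !mxE.
Qed.

Lemma leb_obox n (a b : 'rV[R]_n) : (forall i, a ord0 i < b ord0 i) ->
  (0 < leb n (obox a b) < +oo)%E.
Proof.
elim: n a b => [|n IH] a b ab.
  rewrite /= diracE mem_set/= ?lte01 ?ltry//.
  by case.
rewrite /= /leb_succ /pushforward consrV_obox product_measure1E//; last first.
  exact: measurable_obox.
have lI : lebesgue_measure `](unconsrV a).1, (unconsrV b).1[%classic =
    (b ord0 ord0 - a ord0 ord0)%:E.
  by rewrite lebesgue_measure_itv/= lte_fin ab.
set I := (X in (_ < X * _ < _)%E); have -> : I = _ := lI.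
have /andP[l0 loo] : (0 < leb n (obox (unconsrV a).2 (unconsrV b).2) < +oo)%E.
  by apply: IH => i; rewrite !mxE.
apply/andP; split; first by rewrite mule_gt0// lte_fin subr_gt0.
by rewrite lte_mul_pinfty// ?lee_fin ?subr_ge0 ?ltW.
Qed.

Lemma bounded_leb n (A : set 'rV[R]_n) : measurable A -> bounded_set A ->
  (leb n A < +oo)%E.
Proof.
move=> mA [M [_ AM]].
(* [bounded_set] bounds the norm by every real above [M]; one unit gives such a real, the other
   makes the inclusion in the open box strict. *)
pose b : 'rV[R]_n := const_mx (`|M| + 2).
have M0 := ler_norm M.
have bE i : b ord0 i = `|M| + 2 by rewrite mxE.
have /andP[_ boo] : (0 < leb n (obox (- b) b) < +oo)%E.
  by apply: leb_obox => i; rewrite mxE bE; have := normr_ge0 M; lra.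
apply: le_lt_trans boo; apply: le_measure; rewrite ?inE//.
  exact: measurable_obox.
move=> x Ax i; rewrite mxE bE -ltr_norml (le_lt_trans (coord_norm x i))//.
have /AM/(_ _ Ax) : M < `|M| + 1 by lra.
by move=> /=; lra.
Qed.

Lemma open_leb_gt0 n (A : set 'rV[R]_n) : open A -> A !=set0 -> (0 < leb n A)%E.
Proof.
move=> oA [x Ax]; have [e e0 xeA] := open_obox_nbhs oA Ax.
pose d : 'rV[R]_n := const_mx e.
have /andP[l0 _] : (0 < leb n (obox (x - d) (x + d)) < +oo)%E.
  by apply: leb_obox => i; rewrite !mxE; lra.
apply: (lt_le_trans l0); apply: le_measure; rewrite ?inE.
- exact: measurable_obox.
- exact: open_measurable_rV.
move=> y xy; apply: xeA => i; have := xy i; rewrite !mxE => /andP[? ?].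
by rewrite ltr_norml; apply/andP; split; lra.
Qed.

End LebesgueBox.

(** * Integration by parts *)

Section Slices.
Context {R : realType}.

Lemma continuous_rV (T : topologicalType) n (f : T -> 'rV[R]_n) :
  (forall i, continuous (fun t => f t ord0 i)) -> continuous f.
Proof.
move=> cf t; apply/cvg_ballP => e e0.
have : \forall s \near t, forall i, `|f t ord0 i - f s ord0 i| < e.
  apply: filter_forall => i.
  by have /cvgrPdist_lt/(_ _ e0) := cf i t.
by apply: filterS => s fs; apply/rV_ballP.
Qed.

Lemma continuous_consrV_l n (y : 'rV[R]_n) :
  continuous (fun t => consrV (t, y)).
Proof.
apply: continuous_rV => i; under eq_fun do rewrite mxE.
by case: unliftP => [j _|_] t; [exact: cvg_cst|exact: cvg_id].
Qed.

Lemma continuous_consrV_r n (t : R) :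
  continuous (fun y : 'rV[R]_n => consrV (t, y)).
Proof.
apply: continuous_rV => i; under eq_fun do rewrite mxE.
case: unliftP => [j _|_] y /=; last exact: (@cst_continuous _ _ t y).
exact: (@coord_continuous R _ _ ord0 j y).
Qed.

Lemma consrV_delta0 n (t h : R) (y : 'rV[R]_n) :
  consrV (h + t, y) = h *: delta_mx ord0 ord0 + consrV (t, y).
Proof.
apply/rowP => i; rewrite !mxE; case: unliftP => [j ->|->] /=.
  by rewrite mulr0 add0r.
by rewrite mulr1.
Qed.

Lemma consrV_delta_lift n (t h : R) (y : 'rV[R]_n) j :
  consrV (t, h *: delta_mx ord0 j + y) =
  h *: delta_mx ord0 (lift ord0 j) + consrV (t, y).
Proof.
apply/rowP => i; rewrite !mxE; case: unliftP => [k ->|->] /=.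
  by rewrite !mxE (inj_eq lift_inj).
by rewrite mulr0 add0r.
Qed.

Lemma consrV_norm_ge n (t : R) (y : 'rV[R]_n) :
  `|t| <= `|consrV (t, y)| /\ `|y| <= `|consrV (t, y)|.
Proof.
split.
  by have := coord_norm (consrV (t, y)) ord0; rewrite mxE unlift_none.
rewrite leNgt; apply/negP => cy.
suff : `|y| < `|y| by rewrite ltxx.
apply: rV_norm_lt => [|i]; first by rewrite (le_lt_trans _ cy).
apply: le_lt_trans cy.
by have := coord_norm (consrV (t, y)) (lift ord0 i); rewrite mxE liftK.
Qed.

(** A directional derivative depends only on the restriction to a line, so two functions that agree
    along lines of different spaces have the same difference quotients. This moves derivatives
    between R^(n+1), its slices and R. *)
Lemma is_derive_line (V W : normedModType R) (f : V -> R) (g : W -> R)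
    x v y u d : (forall h, f (h *: v + x) = g (h *: u + y)) ->
  is_derive x v f d -> is_derive y u g d.
Proof.
move=> fg [dfx dfv].
have fgE : (fun h => h^-1 *: ((f \o shift x) (h *: v) - f x)) =
           (fun h => h^-1 *: ((g \o shift y) (h *: u) - g y)).
  apply/funext => h; congr (_ *: (_ - _)); first by rewrite /= fg.
  by have := fg 0; rewrite !scale0r !add0r.
by split; [rewrite /derivable -fgE|rewrite /derive -fgE].
Qed.

(** Restricting [p] to the line through [x] along [v] reduces this to the chain rule in one
    variable; a directional derivative of [p] is enough. *)
Lemma is_derive_comp_dir (V : normedModType R) (f : R -> R) (p : V -> R) x v a b :
  is_derive (p x) (1 : R) f a -> is_derive x v p b ->
  is_derive x v (f \o p) (a * b).
Proof.
move=> df dp; pose q (h : R) := p (h *: v + x).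
have dq : is_derive (0 : R) (1 : R) q b.
  by apply: is_derive_line dp => h; rewrite /q [h *: 1]mulr1 addr0.
have df' : is_derive (q 0) (1 : R) f a by rewrite /q scale0r add0r.
apply: is_derive_line (is_derive1_comp df' dq) => h.
by rewrite /= /q [h *: 1]mulr1 addr0.
Qed.

End Slices.

(** * Compactly supported partial derivatives integrate to zero *)

Section CompactSupport.
Context {R : realType}.

Lemma compact_support_integrable n (D : 'rV[R]_n -> R) (M : R) :
  continuous D -> (forall x, M <= `|x| -> D x = 0) ->
  (leb n).-integrable setT (EFin \o D).
Proof.
move=> cD D0; pose A := [set x : 'rV[R]_n | `|x| < M].
have bA : bounded_set A.
  by exists M; split; [exact: num_real|move=> r Mr x /ltW/le_trans; apply; exact: ltW].
have mA : measurable A.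
  apply: open_measurable_rV.
  apply: (@open_comp _ _ (fun x : 'rV[R]_n => `|x|) [set r | r < M]).
    by move=> x _; exact: norm_continuous.
  exact: open_lt.
have DA : D = D \_ A.
  apply/funext => x; rewrite patchE; case: ifPn => // /negP xA.
  by rewrite D0// leNgt; apply/negP => ?; apply: xA; rewrite inE.
rewrite DA -restrict_EFin -integrable_mkcond//.
apply: measurable_bounded_integrable => //.
- exact: bounded_leb.
- by apply: measurable_funTS; exact: continuous_measurable_rV.
have cB : compact [set x : 'rV[R]_n | `|x| <= M].
  apply: bounded_closed_compact.
    exists M; split; [exact: num_real|move=> r Mr x /le_trans; apply; exact: ltW].
  apply: (@closed_comp _ _ (fun x : 'rV[R]_n => `|x|) [set r | r <= M]).
    by move=> x _; exact: norm_continuous.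
  exact: closed_le.
have /continuous_compact/(_ cB)/compact_bounded[C [_ CB]] :
    {within [set x : 'rV[R]_n | `|x| <= M], continuous D}.
  exact: continuous_subspaceT.
exists C; split; first exact: num_real.
by move=> r Cr x /ltW Ax /=; apply: (CB _ Cr); exists x.
Qed.

(** [leb n.+1] is the image under [consrV] of a product measure, so Fubini applies. Both orders
    serve: the first coordinate is integrated either last or first. *)
Lemma Fubini_consrV n (D : 'rV[R]_n.+1 -> R) (M : R) :
  continuous D -> (forall x, M <= `|x| -> D x = 0) ->
  let F z := (D (consrV z))%:E in
  (\int[leb n.+1]_x (D x)%:E =
    \int[lebesgue_measure]_t \int[leb n]_y F (t, y) /\
  \int[leb n.+1]_x (D x)%:E =
    \int[leb n]_y \int[lebesgue_measure]_t F (t, y))%E.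
Proof.
move=> cD D0 F.
have mD : measurable_fun setT (EFin \o D).
  by apply/measurable_EFinP; exact: continuous_measurable_rV.
have iF : (lebesgue_measure \x leb n)%E.-integrable setT F.
  have /integrableP[_] := compact_support_integrable cD D0.
  rewrite ge0_integral_pushforward//; last 2 first.
  - exact: measurable_consrV.
  - exact: measurableT_comp.
  rewrite preimage_setT => iD; apply/integrableP; split => //.
  by apply: (measurableT_comp mD); exact: measurable_consrV.
have -> : (\int[leb n.+1]_x (D x)%:E = \int[lebesgue_measure \x leb n]_z F z)%E.
  by rewrite integral_pushforward//; exact: measurable_consrV.
by split; [rewrite integral12_prod_meas1|rewrite integral21_prod_meas1].
Qed.

Lemma integral_derivative_eq0 (F D : R -> R) (M : R) : continuous D ->
  (forall x : R, is_derive x (1 : R) F (D x)) ->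
  (forall x, M <= `|x| -> F x = 0 /\ D x = 0) ->
  (\int[lebesgue_measure]_x (D x)%:E = 0)%E.
Proof.
(* Both endpoints of [[- a, a]] lie in the region where [F] vanishes, so the fundamental theorem of
   calculus gives zero. *)
move=> cD dF FD0; pose a : R := `|M| + 1.
have aM : M <= `|a| /\ M <= `|- a|.
  rewrite normrN (ger0_norm (_ : 0 <= a)) ?addr_ge0//.
  by have := ler_norm M; rewrite /a; split; lra.
have a0 : - a < a by rewrite /a; have := normr_ge0 M; lra.
have DE : EFin \o D = (EFin \o D) \_ `[- a, a].
  apply/funext => x; rewrite patchE; case: ifPn => // /negP xa /=.
  congr EFin; apply: (FD0 x _).2; rewrite leNgt; apply/negP => xM; apply: xa.
  rewrite inE/= in_itv/= -ler_norml /a; have := ler_norm M; lra.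
transitivity (\int[lebesgue_measure]_(x in `[(- a)%R, a]) (D x)%:E)%E.
  by rewrite [RHS]integral_mkcond; congr (integral _ _ _); exact: DE.
have cF : continuous F.
  move=> x; apply/differentiable_continuous/derivable1_diffP.
  by case: (dF x).
rewrite (@continuous_FTC2 _ _ F)//.
- by rewrite !(FD0 _ _).1 ?subee//; case: aM.
- exact: continuous_subspaceT.
- split.
  + by move=> x _; case: (dF x).
  + exact/cvg_at_right_filter/cF.
  + exact/cvg_at_left_filter/cF.
- by move=> x _; rewrite derive1E; case: (dF x).
Qed.

(** Induction on the dimension. If [i] is the first coordinate, integrate along it first and use the
    one-variable case; otherwise freeze the first coordinate and apply the induction hypothesis to
    the slice. *)
Lemma integral_partial_eq0 n (i : 'I_n) (F D : 'rV[R]_n -> R) (M : R) :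
  continuous D -> (forall x, is_derive x (delta_mx ord0 i) F (D x)) ->
  (forall x, M <= `|x| -> F x = 0 /\ D x = 0) ->
  (\int[leb n]_x (D x)%:E = 0)%E.
Proof.
elim: n i F D => [[]//|n IH] i F D cD dF FD0.
have D0 x : M <= `|x| -> D x = 0 by move=> /FD0[].
have [F1 F2] := Fubini_consrV cD D0.
have [j|] := unliftP ord0 i => iE.
  rewrite F1; apply: integral0_eq => t _.
  apply: (IH j (fun y => F (consrV (t, y)))).
  - move=> y; apply: continuous_comp; last exact: cD.
    exact: continuous_consrV_r.
  - move=> y; move: (dF (consrV (t, y))); rewrite iE.
    by apply: is_derive_line => h; rewrite consrV_delta_lift.
  - by move=> y My; apply: FD0; apply: le_trans (consrV_norm_ge t y).2.
rewrite F2; apply: integral0_eq => y _.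
apply: (@integral_derivative_eq0 (fun t => F (consrV (t, y))) _ M).
- move=> t; apply: continuous_comp; last exact: cD.
  exact: continuous_consrV_l.
- move=> t; move: (dF (consrV (t, y))); rewrite iE.
  by apply: is_derive_line => h; rewrite -consrV_delta0 [h *: 1]mulr1.
- by move=> t Mt; apply: FD0; apply: le_trans (consrV_norm_ge t y).1.
Qed.

End CompactSupport.

Section IntegrationByParts.
Context {R : realType} {n : nat}.
Implicit Types (Om C : set 'rV[R]_n) (f u z psi : 'rV[R]_n -> R).

(** Nothing is known of [u] outside [Om], but a point outside [Om] has a neighbourhood avoiding [C],
    where the product is zero. *)
Lemma continuous_mul_supported Om C u z : open Om -> closed C -> C `<=` Om ->
  (forall x, Om x -> {for x, continuous u}) -> continuous z ->
  (forall x, ~ C x -> z x = 0) -> continuous (fun x => u x * z x).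
Proof.
move=> oOm cC COm cu cz z0 x; have [Omx|Omx] := pselect (Om x).
  by apply: continuousM; [exact: cu|exact: cz].
have nCx : \forall y \near x, ~ C y.
  apply: open_nbhs_nbhs; split; first exact: closed_openC.
  by move=> /COm.
apply: (@cvg_near_cst _ _ _ _ (nbhs x)); apply: filterS nCx => y nCy.
by rewrite (z0 y)// (z0 x) ?mulr0// => /COm.
Qed.

Lemma supported_norm_ge C z : compact C -> (forall x, ~ C x -> z x = 0) ->
  exists M : R, forall x, M <= `|x| -> z x = 0.
Proof.
move=> /compact_bounded[M [_ CM]] z0; exists (M + 2) => x Mx; apply: z0 => Cx.
have M1 : M < M + 1 by lra.
by have : M + 2 <= M + 1 := le_trans Mx (CM _ M1 _ Cx); lra.
Qed.

Lemma partial_supported psi C i x : closed C -> (forall x, ~ C x -> psi x = 0) ->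
  ~ C x -> partial i psi x = 0.
Proof.
move=> cC psi0 nCx; rewrite /partial.
have : is_derive x (delta_mx ord0 i : 'rV[R]_n) psi 0.
  apply: near_eq_is_derive (is_derive_cst 0 x _) => /=.
  have : \forall y \near x, ~ C y.
    by apply: open_nbhs_nbhs; split => //; exact: closed_openC.
  by apply: filterS => y /psi0 ->.
by case.
Qed.

Lemma test_functionP Om psi (i : 'I_n) : test_function Om psi -> exists C,
  [/\ compact C, closed C, C `<=` Om, continuous psi &
      [/\ forall x, derivable psi x (delta_mx ord0 i),
          continuous (partial i psi), forall x, ~ C x -> psi x = 0 &
          forall x, ~ C x -> partial i psi x = 0]].
Proof.
move=> [ck cS SOm]; set C := closure _ in cS SOm.
have cC : closed C by exact: closed_closure.
have psi0 x : ~ C x -> psi x = 0.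
  move=> Cx; apply/eqP; apply/negPn/negP => psix; apply: Cx.
  exact: subset_closure.
exists C; have [_ /(_ i)[dpsi cpsi]] := ck 1%N.
by split => //; [exact: ck 0%N|split => // x; exact: partial_supported].
Qed.

Lemma integrable_mul_supported Om C u z : open Om -> closed C -> compact C ->
  C `<=` Om -> (forall x, Om x -> {for x, continuous u}) -> continuous z ->
  (forall x, ~ C x -> z x = 0) ->
  (leb n).-integrable Om (fun x => (u x * z x)%:E).
Proof.
move=> oOm cC kC COm cu cz z0.
have [M zM] := supported_norm_ge kC z0.
apply: (@integrableS _ _ _ _ setT) => //; first exact: open_measurable_rV.
apply: (@compact_support_integrable _ _ _ M).
  exact: continuous_mul_supported oOm cC COm cu cz z0.
by move=> x /zM ->; rewrite mulr0.
Qed.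

(** The product [f * psi] vanishes off a compact subset of [Om], hence has continuous partial
    derivatives on the whole space, and their integrals are zero. No regularity of the boundary
    enters. *)
Lemma integration_by_parts_test Om f psi (i : 'I_n) : open Om ->
  (forall x, Om x -> {for x, continuous f}) -> C1_on Om f ->
  test_function Om psi ->
  [/\ (leb n).-integrable Om (fun x => (f x * partial i psi x)%:E),
      (leb n).-integrable Om (fun x => (partial i f x * psi x)%:E) &
      \int[leb n]_(x in Om) (f x * partial i psi x) =
      - \int[leb n]_(x in Om) (partial i f x * psi x)].
Proof.
move=> oOm cf df tpsi.
have [C [kC cC COm cpsi [dpsi cdpsi psi0 dpsi0]]] := test_functionP i tpsi.
have cdf x : Om x -> {for x, continuous (partial i f)}.
  by move=> /df/(_ i)[].
have i1 := integrable_mul_supported oOm cC kC COm cf cdpsi dpsi0.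
have i2 := integrable_mul_supported oOm cC kC COm cdf cpsi psi0.
split => //; apply/eqP; rewrite -subr_eq0 opprK; apply/eqP.
rewrite -RintegralD//; last exact: open_measurable_rV.
rewrite /Rintegral.
set D := fun x => f x * partial i psi x + partial i f x * psi x.
have [M Mpsi] := supported_norm_ge kC psi0.
have [M' Mdpsi] := supported_norm_ge kC dpsi0.
have -> : (\int[leb n]_(x in Om) (D x)%:E = \int[leb n]_x (D x)%:E)%E.
  rewrite integral_mkcond; apply: eq_integral => x _; rewrite patchE.
  case: ifPn => // /negP; rewrite inE => nOm.
  have nC : ~ C x by move=> /COm.
  by rewrite /D psi0// dpsi0// !mulr0 addr0.
suff -> : (\int[leb n]_x (D x)%:E = 0)%E by [].
apply: (@integral_partial_eq0 _ _ i (fun x => f x * psi x) _ (Num.max M M')).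
- have c1 := continuous_mul_supported oOm cC COm cf cdpsi dpsi0.
  have c2 := continuous_mul_supported oOm cC COm cdf cpsi psi0.
  by move=> x; exact: (continuousD (c1 x) (c2 x)).
- move=> x; have [Omx|nOm] := pselect (Om x).
    have [dfx _] := df _ Omx i.
    apply: (@is_derive_eq _ _ _ (f * psi)).
      exact: (is_deriveM (derivableP dfx) (derivableP (dpsi x))).
    by rewrite /D /partial /GRing.scale/=; ring.
  have nCx : ~ C x by move=> /COm.
  rewrite /D psi0// dpsi0// !mulr0 addr0.
  apply: near_eq_is_derive (is_derive_cst 0 x _) => /=.
  have : \forall y \near x, ~ C y.
    by apply: open_nbhs_nbhs; split => //; exact: closed_openC.
  by apply: filterS => y /psi0 ->; rewrite mulr0.
- by move=> x; rewrite ge_max => /andP[/Mpsi psix /Mdpsi dpsix];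
    rewrite /D psix dpsix !mulr0 addr0.
Qed.

End IntegrationByParts.

(** * Smooth bump functions *)

Section FlatFunctions.
Context {R : realType}.

(** [flat 0] is the classical smooth function exp(-1/t) extended by zero. The powers of 1/t are
    included so that derivatives remain linear combinations of members of the family. *)
Definition flat (m : nat) (t : R) : R :=
  if 0 < t then t^-1 ^+ m * expR (- t^-1) else 0.

Lemma flat_le0 m t : t <= 0 -> flat m t = 0.
Proof. by rewrite /flat ltNge => ->. Qed.

(** With s = 1/t, this follows from exp(s) >= s^(m+2) / (m+2)!, whence the constant. It yields the
    derivative at 0, where the two branches meet. *)
Lemma flat_quadratic m : exists2 C : R, 0 < C & forall t, `|flat m t| <= C * t ^+ 2.
Proof.
exists m.+2`!%:R => [|t]; first by rewrite ltr0n fact_gt0.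
rewrite /flat; case: ifPn => [t0|_]; last by rewrite normr0 mulr_ge0// sqr_ge0.
rewrite ger0_norm; last first.
  by rewrite mulr_ge0// ?expR_ge0// exprn_ge0// invr_ge0 ltW.
rewrite expRN ler_pdivrMr ?expR_gt0//.
have f0 : 0 < m.+2`!%:R :> R by rewrite ltr0n fact_gt0.
have t1 : 0 <= t^-1 by rewrite invr_ge0 ltW.
have := expR_ge1Dxn m.+1 t1; set e := expR _ => h.
have : t^-1 ^+ m.+2 / m.+2`!%:R <= e by lra.
rewrite ler_pdivrMr// => {}h.
have -> : t^-1 ^+ m = t^-1 ^+ m.+2 * t ^+ 2.
  by rewrite -addn2 exprD -mulrA -exprMn mulVf ?gt_eqF// expr1n mulr1.
have := ler_wpM2r (sqr_ge0 t) h; rewrite [_ * t ^+ 2 * e]mulrAC.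
by rewrite [e * _]mulrC -mulrA [e * _]mulrC.
Qed.

Lemma is_derive_quadratic (g : R -> R) (C : R) :
  (forall t, `|g t| <= C * t ^+ 2) -> is_derive (0 : R) (1 : R) g 0.
Proof.
move=> gC; have g0 : g 0 = 0.
  by apply/eqP; rewrite -normr_le0 (le_trans (gC _))// expr0n mulr0.
have C0 : 0 <= C by have := gC 1; rewrite expr1n mulr1; exact: le_trans.
have cvg0 : h^-1 *: ((g \o shift 0) (h *: 1) - g 0) @[h --> 0^'] --> (0 : R).
  apply/cvgrPdist_lt => e e0.
  (* The difference quotient is at most [C * |h|]; adding 1 keeps the denominator positive when [C]
     is 0. *)
  have d0 : 0 < e / (C + 1) by rewrite divr_gt0// ltr_wpDl.
  near=> h.
  have h0 : h != 0 by near: h; exact: nbhs_dnbhs_neq.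
  rewrite /= g0 subr0 addr0 sub0r normrN [h *: 1]mulr1 [_ *: _]/(_ * _) normrM.
  have hd : `|h| < e / (C + 1).
    by near: h; apply: dnbhs0_lt.
  rewrite normfV mulrC ltr_pdivrMr ?normr_gt0//.
  apply: le_lt_trans (gC h) _; rewrite -real_normK ?num_real// expr2 mulrA.
  rewrite ltr_pM2r ?normr_gt0//.
  move: hd; rewrite ltr_pdivlMr ?ltr_wpDl//.
  by have := normr_ge0 h; nra.
apply: DeriveDef; first by apply/cvg_ex; exists 0; exact: cvg0.
by apply: cvg_lim => //; exact: cvg0.
Unshelve. all: by end_near. Qed.

Lemma is_derive_flat m (t : R) :
  is_derive t (1 : R) (flat m) (flat m.+2 t - m%:R * flat m.+1 t).
Proof.
have [t0|t0|<-] := ltgtP 0 t.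
- have e : \forall s \near t, s^-1 ^+ m * expR (- s^-1) = flat m s.
    near=> s; rewrite /flat ifT//; near: s.
    by apply: lt_nbhsr.
  apply: (near_eq_is_derive e).
  rewrite /flat t0.
  have dV : is_derive t (1 : R) (fun s : R => s^-1) (- t ^- 2).
    have tn0 : t != 0 by rewrite gt_eqF.
    by have := is_deriveV tn0 (is_derive_id t (1 : R)); rewrite /GRing.scale/= mulr1.
  have dE : is_derive t (1 : R) (fun s : R => expR (- s^-1)) (expR (- t^-1) * t ^- 2).
    have dN : is_derive t (1 : R) (fun s : R => - s^-1) (t ^- 2).
      by rewrite -[t ^- 2]opprK; exact: is_deriveN.
    exact: (is_derive1_comp (is_derive_expR _) dN).
  have := is_deriveX m dV; rewrite exprfctE => dX.
  apply: (is_derive_eq (is_deriveM dX dE)).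
  rewrite /GRing.scale/=.
  have -> : t ^- 2 = t^-1 ^+ 2 by rewrite exprVn.
  case: (m) => [|k]; first by rewrite !mul0r expr0; ring.
  by rewrite /= !exprS expr0; ring.
- have e : \forall s \near t, 0 = flat m s.
    near=> s; rewrite flat_le0//; apply: ltW; near: s.
    by apply: lt_nbhsl.
  rewrite !(flat_le0 _ (ltW t0)) mulr0 subr0.
  exact: (near_eq_is_derive e (is_derive_cst 0 t 1)).
- rewrite !flat_le0// mulr0 subr0.
  by have [C _ /is_derive_quadratic] := flat_quadratic m.
Unshelve. all: by end_near. Qed.

Lemma flat01 (t : R) : 0 <= flat 0 t <= 1.
Proof.
rewrite /flat; case: ifPn => t0; last by rewrite lexx ler01.
rewrite expr0 mul1r expR_ge0 -[leRHS]expR0 ler_expR oppr_le0 invr_ge0.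
exact: ltW.
Qed.

(** With s = 1/t, the upper bound is s^2 <= 2 exp(s), from exp(s) >= 1 + s^2/2. Since [flat 2] is
    the derivative of [flat 0], this bounds the factor of the gradient in the truncation. *)
Lemma flat2_bound (t : R) : 0 <= flat 2 t <= 2.
Proof.
rewrite /flat; case: ifPn => t0; last by rewrite lexx ler0n.
rewrite mulr_ge0 ?expR_ge0 ?sqr_ge0//= expRN ler_pdivrMr ?expR_gt0//.
have t1 : 0 <= t^-1 by rewrite invr_ge0 ltW.
by have := expR_ge1Dxn 1 t1; rewrite (_ : 2`! = 2)%N //; lra.
Qed.

Lemma flat_gt0 m (t : R) : 0 < t -> 0 < flat m t.
Proof. by move=> t0; rewrite /flat t0 mulr_gt0 ?expR_gt0// exprn_gt0 ?invr_gt0. Qed.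

Lemma continuous_flat m : continuous (flat m : R -> R).
Proof.
move=> t; apply/differentiable_continuous/derivable1_diffP.
by have [] := is_derive_flat m t.
Qed.

Lemma cvg_flat (t : R) : 0 < t -> flat 0 (k.+1%:R * t) @[k --> \oo] --> (1 : R).
Proof.
move=> t0.
have -> : (fun k => flat 0 (k.+1%:R * t)) = (fun k => expR (- (t^-1 * harmonic k))).
  apply/funext => k; rewrite /flat mulr_gt0// expr0 mul1r invfM mulrC.
  by [].
have h0 : - (t^-1 * harmonic k) @[k --> \oo] --> (0 : R).
  have := cvgN (cvgMl_tmp (a := t^-1) (@cvg_harmonic R)).
  by rewrite mulr0 oppr0; apply.
by have := cvg_comp _ _ h0 (@continuous_expR R 0); rewrite expR0.
Qed.

End FlatFunctions.

(** * Smooth bumps supported in boxes *)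

Section TestFunctions.
Context {R : realType} {n : nat}.
Implicit Types f g : 'rV[R]_n -> R.

(* Closed under partial derivatives, hence made of smooth functions. *)
Inductive flat_algebra : ('rV[R]_n -> R) -> Prop :=
| flat_gen m (c d : R) i : flat_algebra (fun x => flat m (c * x ord0 i + d))
| flat_cst (c : R) : flat_algebra (fun=> c)
| flat_add f g : flat_algebra f -> flat_algebra g ->
    flat_algebra (fun x => f x + g x)
| flat_mul f g : flat_algebra f -> flat_algebra g ->
    flat_algebra (fun x => f x * g x).

Lemma continuous_flat_algebra f : flat_algebra f -> continuous f.
Proof.
elim=> {f} [m c d i|c|f g _ cf _ cg|f g _ cf _ cg] x.
- apply: (@continuous_comp _ _ _ (fun x : 'rV[R]_n => c * x ord0 i + d) (flat m)).
    apply: (@continuousD _ _ _ (fun x : 'rV[R]_n => c * x ord0 i) (cst d)).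
      apply: (@continuousM _ _ (cst c) (fun x : 'rV[R]_n => x ord0 i)).
        exact: cst_continuous.
      exact: coord_continuous.
    exact: cst_continuous.
  apply/differentiable_continuous/derivable1_diffP.
  by have [] := is_derive_flat m (c * x ord0 i + d).
- exact: cst_continuous.
- exact: (continuousD (cf x) (cg x)).
- exact: (continuousM (cf x) (cg x)).
Qed.

Lemma flat_algebra_derive f i : flat_algebra f -> exists2 df, flat_algebra df &
  forall x, is_derive x (delta_mx ord0 i) f (df x).
Proof.
elim=> {f} [m c d j|c|f g ff [df fdf dfE] fg [dg fdg dgE]
    |f g ff [df fdf dfE] fg [dg fdg dgE]].
- exists (fun x => (c * (j == i)%:R) *
      (flat m.+2 (c * x ord0 j + d) + (- m%:R) * flat m.+1 (c * x ord0 j + d))).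
    apply: flat_mul; first exact: flat_cst.
    apply: flat_add; first exact: flat_gen.
    by apply: flat_mul; [exact: flat_cst|exact: flat_gen].
  move=> x.
  set k := c * (j == i)%:R; set e := c * x ord0 j + d.
  (* Along the line through [x] in direction [i], the generator becomes [flat m (k * h + e)], with
     slope [k] zero unless [i = j]. *)
  have dk : is_derive (0 : R) (1 : R) (fun h => k * h + e) k.
    have : is_derive (0 : R) (1 : R) (k \*: (@id R) + cst e) (k *: 1 + 0).
      exact: is_deriveD.
    by rewrite addr0 [k *: 1]mulr1.
  have dflat : is_derive (k * 0 + e) (1 : R) (flat m)
      (flat m.+2 e - m%:R * flat m.+1 e).
    by rewrite mulr0 add0r; exact: is_derive_flat.
  have dcomp := @is_derive1_comp _ (flat m) (fun h => k * h + e) _ _ _ dflat dk.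
  rewrite mulNr mulrC; apply: is_derive_line dcomp => h.
  rewrite /= !mxE eqxx/= [h *: 1]mulr1 addr0; congr (flat _ _).
  by rewrite /k /e; ring.
- by exists (fun=> 0); [exact: flat_cst|move=> x; exact: is_derive_cst].
- exists (fun x => df x + dg x); first exact: flat_add.
  by move=> x; exact: is_deriveD.
- exists (fun x => f x * dg x + g x * df x).
    by apply: flat_add; exact: flat_mul.
  by move=> x; exact: is_deriveM.
Qed.

Lemma Ck_flat_algebra k f : flat_algebra f -> Ck k f.
Proof.
elim: k f => [|k IH] f ff /=; first exact: continuous_flat_algebra.
split=> [|i]; first exact: continuous_flat_algebra.
have [df fdf dfE] := flat_algebra_derive i ff.
split=> [x|]; first by case: (dfE x).
rewrite (_ : partial i f = df); first exact: IH.
by apply/funext => x; case: (dfE x).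
Qed.

(** Positive exactly on the open box. The factor [k.+1] steepens the sides, so that the bumps tend
    pointwise to the indicator of the box. *)
Definition box_bump (a b : 'rV[R]_n) (k : nat) (x : 'rV[R]_n) : R :=
  \prod_(i < n) (flat 0 (k.+1%:R * (x ord0 i - a ord0 i)) *
                 flat 0 (k.+1%:R * (b ord0 i - x ord0 i))).

Lemma flat_algebra_box_bump a b k : flat_algebra (box_bump a b k).
Proof.
have gen (c d : R) i (f : 'rV[R]_n -> R) :
    (forall x, f x = c * x ord0 i + d) -> flat_algebra (fun x => flat 0 (f x)).
  by move=> /funext ->; exact: flat_gen.
rewrite /box_bump; elim: (index_enum _) => [|i s IH].
  by under eq_fun do rewrite big_nil; exact: flat_cst.
under eq_fun do rewrite big_cons; apply: flat_mul IH; apply: flat_mul.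
  by apply: (gen k.+1%:R (- (k.+1%:R * a ord0 i)) i) => x; ring.
by apply: (gen (- k.+1%:R) (k.+1%:R * b ord0 i) i) => x; ring.
Qed.

Lemma box_bump_eq0 a b k x : ~ obox a b x -> box_bump a b k x = 0.
Proof.
move=> /existsNP[i /negP]; rewrite negb_and -!leNgt => abx.
rewrite /box_bump (bigD1 i)//=; case/orP: abx => ?.
  by rewrite flat_le0 ?mul0r// pmulr_rle0// subr_le0.
by rewrite [flat _ (_ * (b _ _ - _))]flat_le0 ?(mulr0, mul0r)// pmulr_rle0// subr_le0.
Qed.

Lemma box_bump01 a b k x : 0 <= box_bump a b k x <= 1.
Proof.
rewrite /box_bump; elim/big_ind : _ => [|y z /andP[? ?] /andP[? ?]|i _].
- by rewrite ler01 lexx.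
- by rewrite mulr_ge0// mulr_ile1.
- have /andP[? ?] := flat01 (k.+1%:R * (x ord0 i - a ord0 i)).
  have /andP[? ?] := flat01 (k.+1%:R * (b ord0 i - x ord0 i)).
  by rewrite mulr_ge0// mulr_ile1.
Qed.

Lemma cvg_box_bump a b x : box_bump a b k x @[k --> \oo] --> (\1_(obox a b) x : R).
Proof.
rewrite indicE; case: (boolP (x \in _)) => [|/negP]; rewrite inE => abx; last first.
  by under eq_fun do rewrite box_bump_eq0//; exact: cvg_cst.
rewrite /box_bump; elim: (index_enum _) => [|i s IH] /=.
  by under eq_fun do rewrite big_nil; exact: cvg_cst.
under eq_fun do rewrite big_cons.
have /andP[axi xbi] := abx i.
have ca : 0 < x ord0 i - a ord0 i by rewrite subr_gt0.
have cb : 0 < b ord0 i - x ord0 i by rewrite subr_gt0.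
have := cvgM (cvgM (cvg_flat ca) (cvg_flat cb)) IH.
by rewrite !mul1r; apply.
Qed.

Lemma box_bump_test (Om : set 'rV[R]_n) a b k :
  cbox a b `<=` Om -> test_function Om (box_bump a b k).
Proof.
move=> abOm.
have supS : closure [set x | box_bump a b k x != 0] `<=` cbox a b.
  rewrite [X in _ `<=` X](closure_id _).1; last exact: closed_cbox.
  apply: closureS => x /= /eqP bx; apply: sub_obox_cbox.
  by apply: contrapT => /box_bump_eq0.
split.
- by move=> l; apply: Ck_flat_algebra; exact: flat_algebra_box_bump.
- by apply: subclosed_compact supS; [exact: closed_closure|exact: compact_cbox].
- by move=> x /supS; exact: abOm.
Qed.

End TestFunctions.

(** * The fundamental lemma of the calculus of variations *)

Section FundamentalLemma.
Context {R : realType} {n : nat}.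
Implicit Types (Om E : set 'rV[R]_n) (u : 'rV[R]_n -> R).

Definition oboxes : set (set 'rV[R]_n) :=
  [set A | exists a b, A = obox a b].

Lemma obox_setI (a b c d : 'rV[R]_n) :
  let lo := \row_i Num.max (a ord0 i) (c ord0 i) in
  let hi := \row_i Num.min (b ord0 i) (d ord0 i) in
  obox a b `&` obox c d = obox lo hi /\ cbox lo hi `<=` cbox a b.
Proof.
move=> lo hi; split; last first.
  move=> x h i; have := h i; rewrite !mxE ge_max le_min.
  by move=> /andP[/andP[-> _] /andP[-> _]].
apply/seteqP; split => x.
  move=> [abx cdx] i; rewrite !mxE gt_max lt_min.
  by have /andP[-> ->] := abx i; have /andP[-> ->] := cdx i.
move=> h; split=> i; have := h i; rewrite !mxE gt_max lt_min.
  by move=> /andP[/andP[-> _] /andP[-> _]].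
by move=> /andP[/andP[_ ->] /andP[_ ->]].
Qed.

Lemma oboxesI : setI_closed oboxes.
Proof.
by move=> _ _ [a [b ->]] [c [d ->]]; rewrite (obox_setI a b c d).1; do 2 eexists.
Qed.

(** Open boxes are stable under intersection, so with this equality Dynkin's theorem can extend
    identities from boxes to all measurable sets. *)
Lemma measurable_oboxesE : @measurable _ 'rV[R]_n = <<s oboxes >>.
Proof.
apply/seteqP; split; last first.
  apply: smallest_sub; first exact: sigma_algebra_measurable.
  by move=> _ [a [b ->]]; exact: measurable_obox.
have mid : measurable_fun setT (id : g_sigma_algebraType oboxes -> 'rV[R]_n).
  apply: measurable_fun_rVP => i.
  apply: (measurability _ (RGenOpens.measurableE R)).
  move=> _ [_ [a [b ->]] <-]; rewrite setTI.
  (* A slab in coordinate [i] is the union of boxes whose other sides []-k, k[] grow. *)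
  rewrite (_ : _ @^-1` _ = \bigcup_k
    obox (\row_j if j == i then a else - k%:R) (\row_j if j == i then b else k%:R)).
    apply: bigcupT_measurable => k; apply: sub_sigma_algebra.
    by exists (\row_j if j == i then a else - k%:R), (\row_j if j == i then b else k%:R).
  apply/seteqP; split => [x /=|x [k _ xk]]; last first.
    by have := xk i; rewrite !mxE eqxx /= in_itv.
  rewrite in_itv/= => abx; have xk := archi_boundP (normr_ge0 x).
  exists (Num.bound `|x|) => // j; rewrite !mxE; case: eqP => [->//|_].
  by rewrite -ltr_norml; exact: le_lt_trans (coord_norm x j) xk.
move=> A mA; have := mid measurableT A mA.
by rewrite setTI preimage_id.
Qed.

(** Test against the bumps of the box and let [k] grow: they tend to its indicator, and [|u|]
    dominates. *)
Lemma integral_obox_eq0 Om u a b :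
  open Om -> measurable_fun Om u -> cbox a b `<=` Om ->
  (leb n).-integrable (obox a b) (EFin \o u) ->
  (forall psi, test_function Om psi -> \int[leb n]_(x in Om) (u x * psi x)%:E = 0)%E ->
  (\int[leb n]_(x in obox a b) (u x)%:E = 0)%E.
Proof.
move=> oOm mu abOm iu u0.
have mB := measurable_obox a b.
have BOm : obox a b `<=` Om by move=> x /sub_obox_cbox/abOm.
have mu' : measurable_fun (obox a b) u.
  by apply: measurable_funS mu => //; exact: open_measurable_rV.
pose f k x := (u x * box_bump a b k x)%:E.
have f0 k : (\int[leb n]_(x in obox a b) f k x = 0)%E.
  rewrite -(u0 _ (@box_bump_test _ _ Om a b k abOm)).
  rewrite [LHS]integral_mkcond [RHS]integral_mkcond; apply: eq_integral => x _.
  rewrite !patchE; case: ifPn => [|/negP]; rewrite inE => Bx.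
    by rewrite ifT// inE; exact: BOm.
  by rewrite /f box_bump_eq0// mulr0; case: ifP.
have mbump k : measurable_fun (obox a b) (box_bump a b k).
  apply: measurable_funTS; apply: continuous_measurable_rV.
  by apply: continuous_flat_algebra; exact: flat_algebra_box_bump.
have mf k : measurable_fun (obox a b) (f k).
  by apply/measurable_EFinP; exact: measurable_funM.
have f_u : {ae leb n, forall x, obox a b x -> f ^~ x @ \oo --> (EFin \o u) x}.
  apply: aeW => x Bx; apply: cvg_EFin; first exact: nearW.
  have := cvgMl_tmp (a := u x) (@cvg_box_bump _ _ a b x).
  by rewrite indicE mem_set// mulr1; apply.
have f_le : {ae leb n, forall x k, obox a b x -> (`|f k x| <= `|(EFin \o u) x|)%E}.
  apply: aeW => x k Bx; rewrite /f /= lee_fin normrM ler_piMr//.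
  by have /andP[b0 b1] := @box_bump01 _ _ a b k x; rewrite ger0_norm.
have [_ _] := dominated_convergence mB mf (measurable_int _ iu) f_u
  (integrable_abse iu) f_le.
have -> : [sequence (\int[leb n]_(x in obox a b) f k x)%E]_k = cst 0%E.
  by apply/funext => k /=; rewrite f0.
move=> /cvg_lim <-//; exact: lim_cst.
Qed.

(** Dynkin's argument inside a fixed box: the sets [E] for which the integral vanishes include the
    boxes and are stable under complement and countable disjoint union. *)
Lemma integral_sub_obox_eq0 Om u a b E :
  open Om -> measurable_fun Om u -> cbox a b `<=` Om ->
  (leb n).-integrable (obox a b) (EFin \o u) ->
  (forall psi, test_function Om psi -> \int[leb n]_(x in Om) (u x * psi x)%:E = 0)%E ->
  measurable E -> (\int[leb n]_(x in obox a b `&` E) (u x)%:E = 0)%E.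
Proof.
move=> oOm mu abOm iu u0; have mB := measurable_obox a b.
have u0' := integral_obox_eq0 oOm mu _ _ u0.
rewrite measurable_oboxesE; move: E; apply: dynkin_induction.
- exact: measurable_oboxesE.
- exact: oboxesI.
- by rewrite setIT; exact: u0'.
- move=> _ [c [d ->]].
  have [-> sub] := obox_setI a b c d.
  apply: u0'; first exact: subset_trans sub abOm.
  apply: integrableS iu => //; first exact: measurable_obox.
  by rewrite -(obox_setI a b c d).1; exact: subIsetl.
- move=> S mS uS; have := u0' _ _ abOm iu.
  rewrite -{1}(setUIDK (obox a b) S) integral_setU//.
  + by rewrite uS add0e setDE.
  + exact: measurableI.
  + exact: measurableD.
  + by rewrite setUIDK; exact: measurable_int iu.
  + by apply/disj_setPS => x [[_ Sx] [_ /(_ Sx)]].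
- move=> F mF tF uF; rewrite setI_bigcupr integral_bigcup//.
  + by rewrite eseries0.
  + exact: trivIset_setIl.
  + by move=> k; exact: measurableI.
  + apply: integrableS iu => //; last by move=> x [k _ []].
    by apply: bigcupT_measurable => k; exact: measurableI.
Qed.

(** On each closed box inside [Om] the integral of [u] vanishes over every measurable part of the
    open box, so [u] is zero almost everywhere there. Countably many rational boxes cover [Om]. *)
Lemma fundamental_lemma Om u :
  open Om -> measurable_fun Om u ->
  (forall a b, cbox a b `<=` Om -> (leb n).-integrable (obox a b) (EFin \o u)) ->
  (forall psi, test_function Om psi -> \int[leb n]_(x in Om) (u x * psi x)%:E = 0)%E ->
  {ae leb n, forall x, Om x -> u x = 0}.
Proof.
move=> oOm mu iu u0.
pose B (ab : 'rV[rat]_n * 'rV[rat]_n) : set 'rV[R]_n :=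
  let a := map_mx ratr ab.1 in let b := map_mx ratr ab.2 in
  if `[< cbox a b `<=` Om >] then obox a b else set0.
have neg ab : (leb n).-negligible (B ab `&` [set x | u x != 0]).
  rewrite /B; case: ifPn => [/asboolP abOm|_]; last first.
    by rewrite set0I; exact: negligible_set0.
  set a := map_mx _ _ in abOm *; set b := map_mx _ _ in abOm *.
  have iab := iu _ _ abOm.
  have [|N [mN N0 sub]] := integral_ae_eq (measurable_obox a b) iab
    (measurable_cst 0%E).
    move=> E Eab mE; rewrite integral0.
    have <- : obox a b `&` E = E by apply/setIidPr.
    exact: integral_sub_obox_eq0 oOm mu abOm iab u0 mE.
  exists N; split => //; apply: subset_trans sub => x [abx /eqP ux] /=.
  by move=> /(_ abx)[].
(* Enumerates the pairs of rational corners by natural numbers, to form a countable union of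
   negligible sets. *)
pose F k := if unpickle k is Some ab then B ab `&` [set x | u x != 0] else set0.
have /negligible_bigcup : forall k, (leb n).-negligible (F k).
  move=> k; rewrite /F; case: unpickle => [ab|]; first exact: neg.
  exact: negligible_set0.
apply: negligibleS => x /= /not_implyP[Omx /eqP ux].
have [ab [Bx BA]] := open_rat_obox oOm Omx.
exists (pickle ab) => //; rewrite /F pickleK; split => //.
by rewrite /B ifT//; exact/asboolP.
Qed.

End FundamentalLemma.

(** * Closed sets are measurable for the Hausdorff measure *)

Section MetricOuterMeasure.
Context {R : realType} {V : normedModType R}.
Variable mu : {outer_measure set V -> \bar R}.

Definition separated_by (A B : set V) (d : R) :=
  forall x y, A x -> B y -> d <= `|x - y|.

Hypothesis mu_metric : forall A B d, 0 < d -> separated_by A B d ->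
  (mu A + mu B <= mu (A `|` B))%E.

Definition far (C : set V) (j : nat) : set V :=
  [set x | forall c, C c -> j.+1%:R^-1 <= `|x - c|].

Lemma closed_bigcup_far C : closed C -> \bigcup_j far C j = ~` C.
Proof.
move=> cC; apply/seteqP; split => [x [j _ xj] Cx|x nCx].
  by have := xj x Cx; rewrite subrr normr0 leNgt invr_gt0 ltr0n.
have : nbhs x (~` C) by apply: open_nbhs_nbhs; split => //; exact: closed_openC.
move=> /nbhs_ballP[e /= e0 eC]; exists (Num.bound e^-1) => // c Cc.
rewrite leNgt; apply/negP => xc; apply: (eC c) Cc; rewrite -ball_normE /=.
apply: (lt_trans xc); rewrite invf_plt ?posrE//.
have : e^-1 < (Num.bound e^-1)%:R by apply: archi_boundP; rewrite invr_ge0 ltW.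
by move=> /lt_trans; apply; rewrite ltr_nat.
Qed.

Lemma nd_far C i j : (i <= j)%N -> far C i `<=` far C j.
Proof.
move=> ij x xi c /xi; apply: le_trans.
by rewrite lef_pV2 ?posrE// ler_nat.
Qed.

Lemma far_separated C i :
  let d : R := i.+1%:R^-1 - i.+2%:R^-1 in
  0 < d /\ separated_by (~` far C i.+1) (far C i) d.
Proof.
split; first by rewrite subr_gt0 ltf_pV2 ?posrE// ltr_nat.
move=> y x /existsNP[c /not_implyP[Cc /negP]]; rewrite -ltNge => yc /(_ _ Cc) xc.
have : `|x - c| <= `|y - x| + `|y - c|.
  by rewrite -(normrN (y - x)) opprB (le_trans _ (ler_normD _ _))// addrA subrK.
by move=> h; rewrite lerBlDr (le_trans xc)// (le_trans h)// lerD2l ltW.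
Qed.

(** The bound [r i <= a i.+2 - a i] telescopes with step two, which leaves two terms at each end. *)
Lemma sum_annuli_le (a r : nat -> R) (j N : nat) :
  (forall i, r i + a i <= a i.+2) ->
  \sum_(0 <= i < N) r (j + i)%N <= a (j + N).+1 + a (j + N)%N - a j.+1 - a j.
Proof.
move=> ra; elim: N => [|N IH]; first by rewrite big_geq// addn0; lra.
rewrite big_nat_recr//= addnS; have := ra (j + N)%N; move: IH; lra.
Qed.

(** Caratheodory's criterion. The sets [Xj j] exhaust the part of [X] off [C] and stay at positive
    distance from [C], so the supremum [L] of their masses satisfies mu(X & C) + L <= mu X. It
    remains to bound the mass of X off [C] by [L], for which the masses of the annuli [Rj j] must be
    summable. *)
Lemma metric_outer_measure_closed (C : set V) :
  closed C -> caratheodory_measurable mu C.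
Proof.
move=> cC; apply: le_caratheodory_measurable => X.
have [->|Xoo] := eqVneq (mu X) +oo%E; first by rewrite leey.
have fX Y : Y `<=` X -> mu Y \is a fin_num.
  move=> YX; rewrite ge0_fin_numE ?outer_measure_ge0//.
  by rewrite (le_lt_trans (le_outer_measure mu _ _ YX))// ltey.
pose Xj j := X `&` far C j.
have XjX j : Xj j `<=` X by exact: subIsetl.
pose a j := fine (mu (Xj j)).
have aE j : mu (Xj j) = (a j)%:E by rewrite fineK//; exact: fX.
have a_nd i j : (i <= j)%N -> a i <= a j.
  move=> ij; rewrite -lee_fin -!aE; apply: le_outer_measure.
  by apply: setIS; exact: nd_far.
pose Rj j := Xj j.+2 `\` Xj j.+1.
have RjX j : Rj j `<=` X by move=> x [] [].
pose r j := fine (mu (Rj j)).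
have rE j : mu (Rj j) = (r j)%:E by rewrite fineK//; exact: fX.
(* Rj j and Xj j are at positive distance; the sum of the r j telescopes. *)
have ra j : r j + a j <= a j.+2.
  rewrite -lee_fin EFinD -rE -!aE.
  have [d0 dsep] := far_separated C j.
  have sep : separated_by (Rj j) (Xj j) (j.+1%:R^-1 - j.+2%:R^-1).
    move=> y x [[Xy _] nXy] [_ xj]; apply: dsep xj => yj.
    exact: nXy.
  apply: (le_trans (mu_metric d0 sep)); apply: le_outer_measure.
  by move=> x [[]//|[Xx xj]]; split => //; apply: nd_far xj; rewrite -addn2 leq_addr.
pose m := fine (mu (X `&` C)); pose M := fine (mu X).
have mE : mu (X `&` C) = m%:E by rewrite fineK//; apply: fX; exact: subIsetl.
have ME : mu X = M%:E by rewrite fineK//; exact: fX.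
have maM j : m + a j <= M.
  rewrite -lee_fin EFinD -mE -aE -ME.
  have sep : separated_by (X `&` C) (Xj j) j.+1%:R^-1.
    by move=> c x [_ Cc] [_ /(_ _ Cc)]; rewrite distrC.
  have j0 : 0 < j.+1%:R^-1 :> R by rewrite invr_gt0.
  apply: (le_trans (mu_metric j0 sep)); apply: le_outer_measure.
  by move=> x [[]|[]].
have hsup : has_sup (range a).
  split; first by exists (a 0%N), 0%N.
  by exists (M - m) => _ [j _ <-]; have := maM j; lra.
pose L := sup (range a).
have aL j : a j <= L by apply: ub_le_sup; [case: hsup|exists j].
have LM : L <= M - m.
  by apply: ge_sup; [case: hsup|move=> _ [j _ <-]; have := maM j; lra].
(* Cover by [Xj j.+1] and the annuli beyond it: their total is at most [a j.+1] plus
   [2 * L - a j - a j.+1]. *)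
have XC j : (mu (X `&` ~` C) <= (2 * L - a j)%:E)%E.
  have cover : X `&` ~` C `<=` Xj j.+1 `|` \bigcup_i Rj (j + i)%N.
    rewrite -(closed_bigcup_far cC) => x [Xx [k _ xk]].
    have [i] : exists i, Xj (j.+1 + i)%N x.
      by exists k; split => //; apply: nd_far xk; exact: leq_addl.
    elim: i => [|i IH]; first by rewrite addn0; left.
    have [|nx xi] := pselect (Xj (j.+1 + i)%N x); first by move/IH.
    right; exists i => //; split; first by move: xi; rewrite addnS addSn.
    by move: nx; rewrite addSn.
  apply: (le_trans (le_outer_measure mu _ _ cover)).
  apply: (le_trans (outer_measureU2 mu _ _)).
  have sumR : (mu (\bigcup_i Rj (j + i)%N) <= (2 * L - a j - a j.+1)%:E)%E.
    apply: (le_trans (outer_measure_sigma_subadditive mu _)).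
    apply: lime_le; first by apply: is_cvg_nneseries => *; exact: outer_measure_ge0.
    apply: nearW => N /=; under eq_bigr do rewrite rE.
    rewrite sumEFin lee_fin; apply: (le_trans (sum_annuli_le _ _ ra)).
    by have := aL (j + N)%N; have := aL (j + N).+1; lra.
  rewrite aE; apply: (le_trans (leeD2l _ sumR)).
  by rewrite -EFinD lee_fin; lra.
rewrite mE ME; have fC : mu (X `&` ~` C) \is a fin_num by apply: fX; exact: subIsetl.
rewrite -(fineK fC) -EFinD lee_fin; set y := fine _.
have yL j : y <= 2 * L - a j by rewrite -lee_fin fineK.
suff : y <= L by move: LM; lra.
(* If [y > L], some [a j] exceeds [L - (y - L)], which contradicts [y <= 2 * L - a j]. *)
rewrite leNgt; apply/negP => Ly.
have [|_ [j _ <-] ay] := sup_adherent (_ : 0 < y - L) hsup; first by rewrite subr_gt0.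
by have := yL j; rewrite -/L in ay; lra.
Qed.

End MetricOuterMeasure.

(** * The Hausdorff measure is a metric outer measure *)

Section HausdorffMetric.
Context {R : realType} {n : nat}.
Implicit Types A B : set 'rV[R]_n.

Lemma norm_le_enorm (x : 'rV[R]_n) : `|x| <= enorm x.
Proof.
rewrite leNgt; apply/negP => ex.
suff : `|x| < `|x| by rewrite ltxx.
apply: rV_norm_lt => [|i]; first by rewrite (le_lt_trans _ ex)// sqrtr_ge0.
apply: le_lt_trans ex; rewrite -sqrtr_sqr ler_wsqrtr// expr2 /dotv.
rewrite (bigD1 i)//= lerDl sumr_ge0// => j _; exact: sqr_ge0.
Qed.

Lemma gauge_upto_anti s (e e' : R) A : e <= e' ->
  (gauge_upto s e' A <= gauge_upto s e A)%E.
Proof.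
move=> ee'; rewrite [leRHS]/gauge_upto; case: asboolP => [small|_].
  rewrite /gauge_upto asboolT// => x y Ax Ay.
  by apply: le_trans ee'; exact: small.
by rewrite leey.
Qed.

Lemma mu_ext_gauge_anti s (e e' : R) A : e <= e' ->
  (mu_ext (gauge_upto s e') A <= mu_ext (gauge_upto s e) A)%E.
Proof.
move=> ee'; apply: le_ereal_inf_tmp => _ [F cF <-].
apply: (@le_trans _ _ (\sum_(k <oo) gauge_upto s e' (F k))%E).
  by apply: ereal_inf_lbound; exists F.
by apply: lee_nneseries => k *; [exact: gauge_upto_ge0|exact: gauge_upto_anti].
Qed.

(** A set of diameter at most [e < d] cannot meet both [A] and [B], so a covering of the union
    splits into a covering of each without counting any set twice. *)
Lemma mu_ext_gauge_metric s (e d : R) A B : e < d -> separated_by A B d ->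
  (mu_ext (gauge_upto s e) A + mu_ext (gauge_upto s e) B <=
   mu_ext (gauge_upto s e) (A `|` B))%E.
Proof.
move=> ed sep; apply: le_ereal_inf_tmp => _ [F [_ ABF] <-].
(* The sets of the covering that miss [D] are replaced by the empty set, of gauge zero, to keep the
   indexing. *)
pose meet (D : set 'rV[R]_n) k : set 'rV[R]_n :=
  if `[< F k `&` D !=set0 >] then F k else set0.
have le_meet (D : set 'rV[R]_n) : D `<=` A `|` B ->
    (mu_ext (gauge_upto s e) D <= \sum_(k <oo) gauge_upto s e (meet D k))%E.
  move=> DAB; apply: ereal_inf_lbound; exists (meet D) => //; split => // x Dx.
  have [k _ Fkx] := ABF x (DAB x Dx); exists k => //.
  by rewrite /meet ifT//; apply/asboolP; exists x.
apply: (le_trans (leeD (le_meet A (@subsetUl _ _ _)) (le_meet B (@subsetUr _ _ _)))).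
rewrite -nneseriesD//; [|by move=> *; exact: gauge_upto_ge0..].
apply: lee_nneseries => k *.
  by apply: adde_ge0; exact: gauge_upto_ge0.
(* A set that is too large has gauge +oo, and the inequality for that term is trivial. *)
have [small|nsmall] := pselect (forall x y, F k x -> F k y -> enorm (x - y) <= e);
    last by rewrite [leRHS]/gauge_upto asboolF// leey.
rewrite /meet; case: asboolP => [[x [Fx Ax]]|_]; last first.
  by rewrite gauge_upto0 add0e; case: ifP; rewrite // gauge_upto0 gauge_upto_ge0.
case: asboolP => [[y [Fy By]]|_]; last by rewrite gauge_upto0 adde0.
have := le_trans (sep x y Ax By) (le_trans (norm_le_enorm _) (small x y Fx Fy)).
by rewrite leNgt ed.
Qed.

Lemma hausdorff_metric s A B (d : R) : 0 < d -> separated_by A B d ->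
  (hausdorff s A + hausdorff s B <= hausdorff s (A `|` B))%E.
Proof.
move=> d0 sep; set Z := hausdorff s (A `|` B).
have le_ext (D : set 'rV[R]_n) (e : R) : 0 < e ->
    (mu_ext (gauge_upto s e) D <= hausdorff s D)%E.
  by move=> e0; apply: ereal_sup_ubound; exists e.
have ext_ge0 (D : set 'rV[R]_n) (e : R) : (0 <= mu_ext (gauge_upto s e) D)%E.
  exact: (mu_ext_ge0 (gauge_upto_ge0 s e)).
have H (e e' : R) : 0 < e -> 0 < e' ->
    (mu_ext (gauge_upto s e) A + mu_ext (gauge_upto s e') B <= Z)%E.
  (* A common scale, finer than [e] and [e'] and below the separation; refining the scale only
     increases both terms. *)
  move=> e0 e'0; pose m := Num.min (Num.min e e') (d / 2).
  have m0 : 0 < m by rewrite !lt_min e0 e'0 divr_gt0.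
  have md : m < d by rewrite gt_min; apply/orP; right; lra.
  refine (le_trans _ (le_trans (mu_ext_gauge_metric s md sep) (le_ext _ _ m0))).
  by apply: leeD; apply: mu_ext_gauge_anti; rewrite !ge_min lexx ?orbT.
have [->|Zoo] := eqVneq Z +oo%E; first by rewrite leey.
have Zfin : Z \is a fin_num.
  by rewrite ge0_fin_numE ?ltey//; exact: outer_measure_ge0.
have fin (D : set 'rV[R]_n) (e : R) : 0 < e -> D `<=` A `|` B ->
    mu_ext (gauge_upto s e) D \is a fin_num.
  move=> e0 DAB; rewrite ge0_fin_numE//; apply: le_lt_trans (le_ext _ _ e0) _.
  by rewrite (le_lt_trans (le_outer_measure (hausdorff s) _ _ DAB))// ltey.
have finB : hausdorff s B \is a fin_num.
  rewrite ge0_fin_numE ?outer_measure_ge0//.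
  by rewrite (le_lt_trans (le_outer_measure (hausdorff s) _ _ (@subsetUr _ A B)))// ltey.
(* The suprema over [e] and [e'] are taken one at a time, the other term being finite and moved to
   the right. *)
rewrite -leeBrDr//; apply: ge_ereal_sup => _ [e e0 <-].
have fA := fin A e e0 (@subsetUl _ _ _).
rewrite leeBrDr// addeC -leeBrDr//; apply: ge_ereal_sup => _ [e' e'0 <-].
by rewrite leeBrDr// addeC; exact: H.
Qed.

Lemma closed_hausdorff_measurable (C : set 'rV[R]_n) s : closed C ->
  caratheodory_measurable (hausdorff s) C.
Proof.
by apply: metric_outer_measure_closed => A B d; exact: hausdorff_metric.
Qed.

End HausdorffMetric.

(** The preimage of an open interval is the trace on [C] of an open set; both that set and [C] are
    measurable because closed sets are. *)
Lemma closed_continuous_surf_measurable {R : realType} {n : nat}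
    (C : set 'rV[R]_n.+1) (h : 'rV[R]_n.+1 -> R) :
  closed C -> {within C, continuous h} ->
  measurable_fun (C : set (surf_type n)) (h : surf_type n -> R).
Proof.
move=> cC ch; apply: (measurability _ (RGenOpens.measurableE R)).
move=> _ [_ [a [b ->]] <-].
have oab : open `]a, b[%classic by exact: interval_open.
have /open_subspaceP[U oU UE] := (continuousP _).1 ch _ oab.
rewrite setIC -UE; apply: (@measurableI _ (surf_type n)); last first.
  exact: closed_hausdorff_measurable.
rewrite -[U]setCK; apply: (@measurableC _ (surf_type n)).
by apply: closed_hausdorff_measurable; exact: open_closedC.
Qed.

(** * The truncated pressure as a test function *)

Section Integrals.
Context {d : measure_display} {T : measurableType d} {R : realType}.
Variable mu : {measure set T -> \bar R}.

(* K, hence the integrand of the weak balance, need not be measurable. *)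
Lemma ge0_le_integral_nonmeasurable (D : set T) (f g : T -> \bar R) :
  (forall x, D x -> 0 <= f x <= g x)%E ->
  (\int[mu]_(x in D) f x <= \int[mu]_(x in D) g x)%E.
Proof.
move=> fg; rewrite !ge0_integralE; last 2 first.
- by move=> x /fg/andP[]; exact: le_trans.
- by move=> x /fg/andP[].
apply: le_ereal_sup => _ [h hf <-]; exists h => // x; apply: le_trans (hf x) _.
by rewrite !patchE; case: ifPn => // /set_mem/fg/andP[].
Qed.

(** On a set of finite measure, [|f|] is dominated by the integrable function [1 + f ^+ 2]. *)
Lemma square_integrable_integrable (D : set T) (f : T -> R) :
  measurable D -> (mu D < +oo)%E -> square_integrable mu D f ->
  mu.-integrable D (EFin \o f).
Proof.
move=> mD muD [mf f2].
have i2 : mu.-integrable D (fun x => (f x ^+ 2)%:E).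
  apply/integrableP; split; first by apply/measurable_EFinP; exact: measurable_funX.
  by under eq_integral do rewrite gee0_abs ?lee_fin ?sqr_ge0//.
have i1 : mu.-integrable D (EFin \o cst 1).
  by apply: measurable_bounded_integrable => //; exact: bounded_cst.
apply: (le_integrable mD _ _ (integrableD mD i1 i2)).
  exact/measurable_EFinP.
move=> x _ /=; rewrite lee_fin [leRHS]ger0_norm ?addr_ge0 ?sqr_ge0//.
have := sqr_ge0 (`|f x| - 1); rewrite -(real_normK (num_real (f x))).
have := sqr_ge0 `|f x|; lra.
Qed.

Lemma bounded_square_integrable (D : set T) (f : T -> R) (C : R) :
  measurable D -> (mu D < +oo)%E -> measurable_fun D f ->
  (forall x, D x -> `|f x| <= C) -> square_integrable mu D f.
Proof.
move=> mD muD mf fC; split => //.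
apply: (@le_lt_trans _ _ (\int[mu]_(x in D) (cst (C ^+ 2)%:E x))%E).
  apply: ge0_le_integral_nonmeasurable => x Dx; rewrite /= !lee_fin sqr_ge0/=.
  rewrite -(real_normK (num_real (f x))) lerXn2r ?nnegrE ?fC//.
  by rewrite (le_trans _ (fC x Dx)).
by rewrite integral_cst// lte_mul_pinfty// lee_fin sqr_ge0.
Qed.

Lemma square_integrableM (D : set T) (f h : T -> R) (C : R) :
  measurable D -> measurable_fun D h -> (forall x, D x -> `|h x| <= C) ->
  square_integrable mu D f -> square_integrable mu D (fun x => h x * f x).
Proof.
move=> mD mh hC [mf f2]; split; first exact: measurable_funM.
apply: (@le_lt_trans _ _ (\int[mu]_(x in D) ((C ^+ 2)%:E * (f x ^+ 2)%:E))%E).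
  apply: ge0_le_integral_nonmeasurable => x Dx; rewrite -EFinM !lee_fin sqr_ge0/=.
  rewrite exprMn ler_wpM2r ?sqr_ge0// -(real_normK (num_real (h x))).
  by rewrite lerXn2r ?nnegrE ?hC// (le_trans _ (hC x Dx)).
rewrite ge0_integralZl//; last 3 first.
- by apply/measurable_EFinP; exact: measurable_funX.
- by move=> x _; rewrite lee_fin sqr_ge0.
- by rewrite lee_fin sqr_ge0.
by rewrite lte_mul_pinfty// lee_fin sqr_ge0.
Qed.

Lemma ae_square_integrable (D : set T) (f g : T -> R) :
  measurable D -> measurable_fun D g -> {ae mu, forall x, D x -> f x = g x} ->
  square_integrable mu D f -> square_integrable mu D g.
Proof.
move=> mD mg fg [mf f2]; split => //.
rewrite -(@ge0_ae_eq_integral _ _ _ mu D (fun x => (f x ^+ 2)%:E))//.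
- by apply/measurable_EFinP; exact: measurable_funX.
- by apply/measurable_EFinP; exact: measurable_funX.
- by move=> x _; rewrite lee_fin sqr_ge0.
- by move=> x _; rewrite lee_fin sqr_ge0.
- by apply: filterS fg => x fg Dx; rewrite fg.
Qed.

End Integrals.

(** * Functions with vanishing partial derivatives *)

Section LocallyConstant.
Context {R : realType} {n : nat}.
Implicit Types (f : 'rV[R]_n -> R) (x y z v : 'rV[R]_n).

Lemma is_derive_segment_cst f z v (T : R) : 0 <= T ->
  (forall t, 0 <= t <= T -> is_derive (t *: v + z) v f 0) ->
  f (T *: v + z) = f z.
Proof.
move=> T0 df; pose g (t : R) := f (t *: v + z).
have dg (t : R) : 0 <= t <= T -> is_derive t (1 : R) g 0.
  move=> /df; apply: is_derive_line => h.
  by rewrite /g scalerDl addrA [h *: 1]mulr1.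
have [||c _] := @MVT_segment R g (fun=> 0) 0 T T0.
- by move=> t; rewrite in_itv/= => /andP[? ?]; apply: dg; rewrite !ltW.
- apply: derivable_within_continuous => t; rewrite in_itv/= => t0T.
  by have [] := dg t t0T.
by rewrite mul0r /g scale0r add0r => /eqP; rewrite subr_eq0 => /eqP.
Qed.

Lemma partial_eq0_box f x (e : R) : 0 < e ->
  (forall y, (forall i, `|x ord0 i - y ord0 i| < e) ->
    forall i, is_derive y (delta_mx ord0 i : 'rV[R]_n) f 0) ->
  forall y, (forall i, `|x ord0 i - y ord0 i| < e) -> f y = f x.
Proof.
move=> e0 df.
(* Two points of the cube that differ in one coordinate are joined by an axis-parallel segment
   inside the cube, along which [f] is constant. *)
have step (u w : 'rV[R]_n) k : (forall i, `|x ord0 i - u ord0 i| < e) ->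
    (forall i, `|x ord0 i - w ord0 i| < e) ->
    (forall i, i != k -> u ord0 i = w ord0 i) -> f u = f w.
  wlog uw : u w / u ord0 k <= w ord0 k => [hw|] xu xw uwE.
    have [/hw|/ltW/hw] := leP (u ord0 k) (w ord0 k); first exact.
    by move=> /(_ xw xu) <-// i ik; rewrite uwE.
  have wE : w = (w ord0 k - u ord0 k) *: delta_mx ord0 k + u.
    apply/rowP => i; rewrite !mxE eqxx /=; case: (eqVneq i k) => [->|ik] /=.
      by rewrite mulr1 subrK.
    by rewrite mulr0 add0r uwE.
  rewrite [in RHS]wE; apply/esym/is_derive_segment_cst; first by rewrite subr_ge0.
  move=> t /andP[t0 tw].
  apply: df => i; rewrite !mxE eqxx /=; case: (eqVneq i k) => [->|ik] /=.
    have := xu k; have := xw k; rewrite mulr1 !ltr_norml.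
    by move=> /andP[? ?] /andP[? ?]; apply/andP; split; lra.
  by rewrite mulr0 add0r.
(* A path from [x] to [y] that changes one coordinate at a time. *)
move=> y xy; pose z k := \row_(i < n) if (i < k)%N then y ord0 i else x ord0 i.
have zn : z n = y by apply/rowP => i; rewrite mxE ltn_ord.
have z0 : z 0%N = x by apply/rowP => i; rewrite mxE.
suff H k : (k <= n)%N -> f (z k) = f x by rewrite -zn; exact: H.
elim: k => [|k IH] kn; first by rewrite z0.
rewrite -IH; last exact: ltnW.
have zx j i : `|x ord0 i - z j ord0 i| < e.
  by rewrite mxE; case: ifP => // _; rewrite subrr normr0.
apply: (step _ _ (Ordinal kn)) => // i ik; rewrite !mxE ltnS leq_eqVlt.
by have /negbTE -> : nat_of_ord i != k by apply: contra ik => /eqP ik; apply/eqP/val_inj.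
Qed.

End LocallyConstant.

Section Topology.
Context {R : realType} {V : topologicalType}.

(** The preimage of [C] is closed relative to the closure and contains [Om]. It carries both the
    lower bound and the constancy of the pressure up to the boundary. *)
Lemma closure_within_closed (Om : set V) (p : V -> R) (C : set R) :
  {within closure Om, continuous p} -> closed C ->
  (forall x, Om x -> C (p x)) -> forall x, closure Om x -> C (p x).
Proof.
move=> cp cC OmC x clx.
have /closed_subspaceP[U cU UE] := (continuous_closedP _).1 cp _ cC.
have : (U `&` closure Om) x.
  split => //; rewrite (closure_id U).1//; apply: closureS clx => y Omy.
  have : (p @^-1` C `&` closure Om) y by split; [exact: OmC|exact: subset_closure].
  by rewrite -UE => -[].
by rewrite UE => -[].
Qed.

Lemma within_closure_continuous (Om : set V) (p : V -> R) : open Om ->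
  {within closure Om, continuous p} -> forall x, Om x -> {for x, continuous p}.
Proof.
move=> oOm /(continuous_subspaceW (@subset_closure _ Om)).
by rewrite continuous_open_subspace// => cp x Omx; apply: cp; rewrite inE.
Qed.

End Topology.

Section Sobolev.
Context {R : realType} {n : nat}.
Implicit Types (Om : set 'rV[R]_n.+1) (p : 'rV[R]_n.+1 -> R).

Lemma weak_grad_ae_partial Om p (G : 'rV[R]_n.+1 -> 'rV[R]_n.+1) (i : 'I_n.+1) :
  open Om -> (leb n.+1 Om < +oo)%E -> (forall x, Om x -> {for x, continuous p}) ->
  C1_on Om p -> H1 Om p G ->
  {ae leb n.+1, forall x, Om x -> G x ord0 i = partial i p x}.
Proof.
move=> oOm Omoo cp dp [_ /(_ i) G2 wG].
have mOm := open_measurable_rV oOm.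
have cdp x : Om x -> {for x, continuous (partial i p)} by move=> /dp/(_ i)[].
have mdp : measurable_fun Om (partial i p) by exact: open_continuous_measurable.
have iG := square_integrable_integrable mOm Omoo G2.
have mG := G2.1.
pose u x := G x ord0 i - partial i p x.
(* The weak gradient is integrable because square integrable on a set of finite measure, the
   classical one because it is bounded on a compact box. *)
have u_box a b : cbox a b `<=` Om ->
    (leb n.+1).-integrable (obox a b) (EFin \o u).
  move=> abOm; have mB := measurable_obox a b.
  have BOm := subset_trans (@sub_obox_cbox _ _ a b) abOm.
  rewrite (_ : EFin \o u = (EFin \o (fun x => G x ord0 i)) \- (EFin \o partial i p))%E//.
  apply: integrableB => //; first exact: integrableS iG.
  apply: measurable_bounded_integrable => //.
  - by apply: (le_lt_trans _ Omoo); apply: le_measure; rewrite ?inE.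
  - exact: measurable_funS mdp.
  - have /continuous_compact/(_ (@compact_cbox _ _ a b))/compact_bounded[C [Creal CB]] :
        {within cbox a b, continuous (partial i p)}.
      by apply: continuous_in_subspaceT => x /set_mem/abOm; exact: cdp.
    exists C; split => // r Cr x /sub_obox_cbox abx /=.
    by apply: (CB _ Cr); exists x.
have u_test psi : test_function Om psi ->
    (\int[leb n.+1]_(x in Om) (u x * psi x)%:E = 0)%E.
  move=> tpsi.
  have [_ idp ibp] := integration_by_parts_test i oOm cp dp tpsi.
  have [C [kC cC COm cpsi [_ _ psi0 _]]] := test_functionP i tpsi.
  have mpsi : measurable_fun Om psi.
    by apply: measurable_funTS; exact: continuous_measurable_rV.
  have iGpsi : (leb n.+1).-integrable Om (EFin \o (fun x => G x ord0 i * psi x)).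
    apply: (integrableMl mOm iG mpsi).
    have /continuous_compact/(_ kC)/compact_bounded[M [Mreal MB]] :
      {within C, continuous psi} by exact: continuous_subspaceT.
    exists (Num.max M 0); split; first exact: num_real.
    move=> r; rewrite gt_max => /andP[Mr r0] x Omx /=.
    have [Cx|nCx] := pselect (C x); first by apply: (MB _ Mr); exists x.
    by rewrite psi0// normr0 ltW.
  have := wG _ tpsi i; rewrite ibp => /oppr_inj E.
  transitivity (\int[leb n.+1]_(x in Om)
      ((G x ord0 i * psi x)%:E - (partial i p x * psi x)%:E))%E.
    by apply: eq_integral => x _; rewrite -EFinB mulrBl.
  rewrite integralB_EFin//.
  rewrite -(fineK (integrable_fin_num mOm iGpsi)) -(fineK (integrable_fin_num mOm idp)).
  by rewrite -EFinB; move: E; rewrite /Rintegral => ->; rewrite subrr.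
have mu : measurable_fun Om u by exact: measurable_funB.
apply: filterS (fundamental_lemma oOm mu u_box u_test) => x ux Omx.
by apply/eqP; rewrite -subr_eq0; apply/eqP; exact: ux.
Qed.

(** The set where [q > 0] is open and negligible, and a nonempty open set has positive measure. *)
Lemma continuous_ge0_integral_eq0 m (Om : set 'rV[R]_m) (q : 'rV[R]_m -> R) : open Om ->
  (forall x, Om x -> {for x, continuous q}) -> (forall x, Om x -> 0 <= q x) ->
  (\int[leb m]_(x in Om) (q x)%:E = 0)%E -> forall x, Om x -> q x = 0.
Proof.
move=> oOm cq q0 iq x Omx; apply/eqP; rewrite eq_le q0// andbT leNgt.
apply/negP => qx.
have mOm := open_measurable_rV oOm.
have mq := open_continuous_measurable oOm cq.
have meq : measurable_fun Om (EFin \o q) by exact/measurable_EFinP.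
have : (\int[leb m]_(x in Om) `|(q x)%:E| = 0)%E.
  by rewrite -iq; apply: eq_integral => y /set_mem Omy; rewrite gee0_abs// lee_fin q0.
move=> /(ae_eq_integral_abs (leb m) mOm meq)[N [mN N0 sub]].
pose U := Om `&` [set y | 0 < q y].
have oU : open U.
  rewrite openE => y [Omy qy]; apply: filterI; first exact: open_nbhs_nbhs.
  by apply: (cq y Omy [set r | 0 < r]); apply: open_nbhs_nbhs; split => //.
have UN : U `<=` N.
  by move=> y [Omy qy]; apply: sub => /(_ Omy)[] qy0; move: qy; rewrite /= qy0 ltxx.
have := open_leb_gt0 oU (ex_intro _ x (conj Omx qx)).
have : (leb m U <= leb m N)%E.
  by apply: le_measure; rewrite ?inE//; exact: open_measurable_rV.
by rewrite [X in (_ <= X)%E](N0 : leb m N = 0%E) => /le_lt_trans /[apply]; rewrite ltxx.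
Qed.

End Sobolev.

(** * Admissibility of the truncated pressure *)

Section Truncation.
Context {R : realType} {n : nat}.
Variables (Om Gp : set 'rV[R]_n.+1) (p : 'rV[R]_n.+1 -> R) (m : R).

(* [- flat 0 (m - s)] is a smooth substitute for [min (s - m) 0]. *)
Definition trunc x := - flat 0 (m - p x).
(** The chain rule: the derivative of [flat 0] is [flat 2], and the two minus signs cancel. *)
Definition trunc_grad x : 'rV[R]_n.+1 := flat 2 (m - p x) *: grad p x.

Lemma trunc_bound x : `|trunc x| <= 1.
Proof. by rewrite normrN; have /andP[t0 t1] := flat01 (m - p x); rewrite ger0_norm. Qed.

Lemma is_derive_trunc x i : derivable p x (delta_mx ord0 i) ->
  is_derive x (delta_mx ord0 i : 'rV[R]_n.+1) trunc (trunc_grad x ord0 i).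
Proof.
move=> /derivableP dp; rewrite /trunc_grad mxE [grad _ _ _ _]mxE.
have dmp : is_derive x (delta_mx ord0 i : 'rV[R]_n.+1) (fun y => m - p y)
    (0 - partial i p x).
  exact: (is_deriveB (is_derive_cst m x _) dp).
have := is_deriveN (@is_derive_comp_dir R _ (flat 0) (fun y => m - p y) _ _ _ _
  (is_derive_flat 0 (m - p x)) dmp).
rewrite (_ : - (_ * _) = flat 2 (m - p x) * partial i p x)//.
by ring.
Qed.

Hypothesis oOm : open Om.

Lemma continuous_trunc (A : set 'rV[R]_n.+1) :
  {within A, continuous p} -> {within A, continuous trunc}.
Proof.
move=> cpA x.
have c1 : {for x, continuous (fun y : subspace A => m - p y)}.
  exact: (continuousB (@cst_continuous (subspace A) R m x) (cpA x)).
exact: (continuousN (continuous_comp c1 (@continuous_flat R 0 _))).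
Qed.

Hypothesis cp : {within closure Om, continuous p}.
Hypothesis dp : C1_on Om p.

Let cpOm x : Om x -> {for x, continuous p}.
Proof. exact: within_closure_continuous. Qed.

Lemma continuous_trunc_coef k x : Om x ->
  {for x, continuous (fun y => flat k (m - p y))}.
Proof.
move=> Omx; apply: (@continuous_comp _ _ _ (fun y => m - p y)).
  exact: (continuousB (@cst_continuous 'rV[R]_n.+1 R m x) (cpOm Omx)).
exact: continuous_flat.
Qed.

Lemma continuous_trunc_grad x i : Om x ->
  {for x, continuous (fun y => trunc_grad y ord0 i)}.
Proof.
move=> Omx; have -> : (fun y => trunc_grad y ord0 i) =
    (fun y => flat 2 (m - p y) * partial i p y).
  by apply/funext => y; rewrite /trunc_grad mxE [grad _ _ _ _]mxE.
have [_ cdp] := dp Omx i.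
exact: (continuousM (@continuous_trunc_coef 2 x Omx) cdp).
Qed.

Lemma partial_trunc x i : Om x -> partial i trunc x = trunc_grad x ord0 i.
Proof. by move=> /dp/(_ i)[/is_derive_trunc[]]. Qed.

Lemma C1_on_trunc : C1_on Om trunc.
Proof.
move=> x Omx i; split; first by have [/is_derive_trunc[]] := dp Omx i.
have e : \forall y \near x, trunc_grad y ord0 i = partial i trunc y.
  have : nbhs x Om by exact: open_nbhs_nbhs.
  by apply: filterS => y /partial_trunc ->.
have := @continuous_trunc_grad x i Omx.
rewrite /prop_for /continuous_at partial_trunc//; apply: cvg_trans.
exact: (@near_eq_cvg _ _ (nbhs x) _ (fun y => trunc_grad y ord0 i) _ e).
Qed.

Hypothesis bOm : bounded_set Om.
Hypothesis hH1 : exists G, H1 Om p G.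
Hypothesis pGp : forall x, Gp x -> m <= p x.

Lemma trunc_admissible : admissible Om Gp trunc trunc_grad trunc.
Proof.
have mOm := open_measurable_rV oOm.
have Omoo := bounded_leb mOm bOm.
have cw x : Om x -> {for x, continuous trunc}.
  exact/(within_closure_continuous oOm (continuous_trunc cp)).
have wH1 : H1 Om trunc trunc_grad.
  split.
  - apply: (bounded_square_integrable (C := 1)) => //.
    + exact: open_continuous_measurable.
    + by move=> x _; exact: trunc_bound.
  - move=> i; have [G hG] := hH1.
    have mdp : measurable_fun Om (partial i p).
      by apply: open_continuous_measurable => // x /dp/(_ i)[].
    (* Square integrability passes from the weak gradient to the classical one, which equals it
       almost everywhere. *)
    have dp2 : square_integrable (leb n.+1) Om (partial i p).
      apply: ae_square_integrable mdp _ _ => //.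
        exact: weak_grad_ae_partial oOm Omoo cpOm dp hG.
      by case: hG => _ /(_ i).
    rewrite (_ : (fun x => _) = (fun x => flat 2 (m - p x) * partial i p x)).
      apply: (square_integrableM (C := 2)) dp2 => //.
        by apply: open_continuous_measurable => // x; exact: continuous_trunc_coef.
      by move=> x _; have /andP[t0 t1] := flat2_bound (m - p x); rewrite ger0_norm.
    by apply/funext => y; rewrite /trunc_grad mxE [grad _ _ _ _]mxE.
  - move=> psi tpsi i.
    have [_ _ ->] := integration_by_parts_test i oOm cw C1_on_trunc tpsi.
    congr (- fine _); apply: eq_integral => x /set_mem Omx.
    by rewrite partial_trunc.
split => //; last first.
  apply: aeW => x Gpx; rewrite /trunc flat_le0 ?oppr0// subr_le0; exact: pGp.
have cwcl := continuous_trunc cp.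
split.
  apply: closed_continuous_surf_measurable.
    apply: closedI; first exact: closed_closure.
    exact: open_closedC.
  by apply: continuous_subspaceW cwcl; exact: subIsetl.
have zero d (T : measurableType d) (mu : {measure set T -> \bar R}) D (f : T -> R) :
    (fun k : nat => \int[mu]_(x in D) ((f x - f x) ^+ 2)%:E)%E @ \oo --> 0%E.
  rewrite (_ : (fun=> _) = cst 0%E); first exact: cvg_cst.
  apply/funext => k; apply: integral0_eq => x _.
  by rewrite subrr expr0n.
(* The truncation is continuous up to the boundary, so a constant sequence exhibits it as its own
   trace. *)
by exists (fun=> trunc), (fun=> trunc_grad); split => // *; exact: zero.
Qed.

End Truncation.

(** * The minimum principle *)

Section DotProduct.
Context {R : realType} {n : nat}.
Implicit Types x y : 'rV[R]_n.

Lemma dotvZl (a : R) x y : dotv (a *: x) y = a * dotv x y.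
Proof. by rewrite /dotv mulr_sumr; apply: eq_bigr => i _; rewrite mxE mulrA. Qed.

Lemma dotvC x y : dotv x y = dotv y x.
Proof. by apply: eq_bigr => i _; rewrite mulrC. Qed.

Lemma dotv_ge0 x : 0 <= dotv x x.
Proof. by apply: sumr_ge0 => i _; exact: sqr_ge0. Qed.

Lemma dotv_eq0 x : dotv x x = 0 -> x = 0.
Proof.
move=> /eqP; rewrite psumr_eq0 => [/allP x0|i _]; last exact: sqr_ge0.
apply/rowP => i; rewrite mxE; apply/eqP.
by have := x0 i (mem_index_enum i); rewrite mulf_eq0 orbb.
Qed.

End DotProduct.

Section Coefficients.
Context {R : realType} {n : nat}.
Variables (xi : 'rV[R]_n.+1 -> R) (p : 'rV[R]_n.+1 -> R) (mu0 p0 beta : R).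

Definition mobility x : R :=
  (modified_viscosity mu0 p0 beta xi x * barus_factor p0 beta (p x))^-1.

Lemma mobility_gt0 x : 0 < mu0 -> 0 < mobility x.
Proof. by move=> ?; rewrite invr_gt0 !mulr_gt0// expR_gt0. Qed.

Lemma continuous_mobility x : 0 < mu0 -> {for x, continuous xi} ->
  {for x, continuous p} -> {for x, continuous mobility}.
Proof.
move=> mu00 cxi cp.
have -> : mobility = (fun y => mu0^-1 *
    expR (beta * xi y / p0 - beta * (p y / p0 - 1))).
  apply/funext => y; rewrite /mobility /modified_viscosity /barus_factor.
  by rewrite !invfM -!expRN opprK expRD mulrA.
have cM (a : R) (f : 'rV[R]_n.+1 -> R) : {for x, continuous f} ->
    {for x, continuous (fun y => a * f y)}.
  by move=> cf; exact: (continuousM (@cst_continuous 'rV[R]_n.+1 R a x) cf).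
have cMr (a : R) (f : 'rV[R]_n.+1 -> R) : {for x, continuous f} ->
    {for x, continuous (fun y => f y * a)}.
  by move=> cf; exact: (continuousM cf (@cst_continuous 'rV[R]_n.+1 R a x)).
apply: (cM _ _); apply: (@continuous_comp _ _ _
    (fun y => beta * xi y / p0 - beta * (p y / p0 - 1)) (@expR R));
  last exact: continuous_expR.
apply: (@continuousB _ _ _ (fun y => beta * xi y / p0)
  (fun y => beta * (p y / p0 - 1))).
  exact: (cMr _ _ (cM _ _ cxi)).
apply: (cM _ _); apply: (@continuousB _ _ _ (fun y => p y / p0) (cst 1)).
  exact: (cMr _ _ cp).
exact: cst_continuous.
Qed.

End Coefficients.

(** The infimum of a real set is a lower bound only when the set is bounded below; here the data are
    values of [p], which is continuous on the compact closure of [Om]. *)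
Lemma Gp_lower_bound (R : realType) (n : nat) (Om Gp Gv : set 'rV[R]_n.+1)
    (p pp : 'rV[R]_n.+1 -> R) :
  bounded_set Om -> Gp `|` Gv = boundary Om -> {within closure Om, continuous p} ->
  (forall x, Gp x -> p x = pp x) -> forall x, Gp x -> inf (pp @` Gp) <= p x.
Proof.
move=> bOm GU cp ppE x Gpx; rewrite ppE//.
have GpOm y : Gp y -> closure Om y.
  by move=> Gpy; have [] : boundary Om y by rewrite -GU; left.
have kOm : compact (closure Om).
  apply: bounded_closed_compact; last exact: closed_closure.
  have [M [Mreal OmM]] := bOm; exists M; split => // r Mr y.
  pose B := [set z : 'rV[R]_n.+1 | `|z| <= r].
  have cB : closed B.
    apply: (@closed_comp _ _ (fun x : 'rV[R]_n.+1 => `|x|) [set s | s <= r]).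
      by move=> z _; exact: norm_continuous.
    exact: closed_le.
  move=> cly; suff : B y by [].
  by rewrite (closure_id B).1//; apply: closureS cly => z; exact: OmM.
have [C [_ CB]] := compact_bounded (continuous_compact cp kOm).
apply: ge_inf; last by exists x.
exists (- (C + 1)) => _ [y Gpy <-]; rewrite -ppE// lerNl.
have C1 : C < C + 1 by rewrite ltrDl.
have /= := CB _ C1 (p y) (ex_intro2 _ _ y (GpOm y Gpy) erefl).
by move=> h; apply: le_trans h; rewrite -normrN ler_norm.
Qed.

(** The level set of [p] through [x] is closed in [Om] by continuity. It is open because all its
    points share the value [p x < m], so that local constancy applies to each of them. *)
Lemma connected_locally_constant_below (R : realType) (V : topologicalType)
    (Om : set V) (p : V -> R) (m : R) :
  open Om -> connected Om -> (forall x, Om x -> {for x, continuous p}) ->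
  (forall x, Om x -> p x < m -> \forall y \near x, p y = p x) ->
  forall x, Om x -> p x < m -> forall y, Om y -> p y = p x.
Proof.
move=> oOm kOm cp lc x Omx pxm y Omy.
pose S := Om `&` [set z | p z = p x].
have oC : open [set r : R | r != p x].
  have -> : [set r : R | r != p x] = ~` [set r | r = p x].
    by apply/seteqP; split => r /eqP.
  by apply: closed_openC; exact: closed_eq.
suff SE : S = Om by have [] : S y by rewrite SE.
apply: kOm; first by exists x.
- exists S; last by rewrite /S setIA setIid.
  rewrite openE => z [Omz pz]; apply: filterI; first exact: open_nbhs_nbhs.
  have : \forall y \near z, p y = p z by apply: lc => //; rewrite pz.
  by apply: filterS => t /= ->.
- exists (~` (Om `&` [set z | p z != p x])).
    apply: open_closedC; rewrite openE => z [Omz pz].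
    apply: filterI; first exact: open_nbhs_nbhs.
    by apply: (cp z Omz [set r | r != p x]); exact: open_nbhs_nbhs.
  apply/seteqP; split => z [Omz pz]; split => //.
    by move=> [_ /eqP]; apply.
  by apply: contrapT => /eqP pz'; apply: pz.
Qed.

Theorem theorem5 (R : realType) (n : nat)
  (Om Gp Gv : set 'rV[R]_n.+1)
  (K : 'rV[R]_n.+1 -> 'M[R]_n.+1) (k1 k2 : R)
  (mu0 p0 beta : R)
  (rho xi : 'rV[R]_n.+1 -> R) (b : 'rV[R]_n.+1 -> 'rV[R]_n.+1)
  (pp vn : 'rV[R]_n.+1 -> R)
  (p : 'rV[R]_n.+1 -> R) (v : 'rV[R]_n.+1 -> 'rV[R]_n.+1)
  (hOm : lipschitz_domain Om)
  (hGU : Gp `|` Gv = boundary Om) (hGI : Gp `&` Gv = set0)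
  (hGp : Gp !=set0)
  (hKsym : forall x, Om x -> (K x)^T = K x)
  (hk1 : 0 < k1) (hk12 : k1 <= k2)
  (hK : forall x, Om x -> forall z : 'rV[R]_n.+1, z != 0 ->
     k1 * dotv z z <= dotv z (mulmxv (K x) z) <= k2 * dotv z z)
  (hmu0 : 0 < mu0) (hp0 : 0 < p0) (hbeta : 0 <= beta)
  (hxi : forall x, Om x -> differentiable xi x)
  (hb : forall x, Om x -> rho x *: b x = - grad xi x)
  (hvn : flux_data Om Gp Gv vn)
  (hsol : weak_solution Om Gp Gv K
     (modified_viscosity mu0 p0 beta xi) (barus_factor p0 beta) pp vn p v)
  (hvn_le0 : forall x, Gv x -> vn x <= 0) :
  forall x, closure Om x -> inf (pp @` Gp) <= p x.
Proof.
have [oOm kOm bOm _] := hOm.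
have [hH1 dp cp ppE darcy balance] := hsol.
have cpOm := within_closure_continuous oOm cp.
have mGp := Gp_lower_bound bOm hGU cp ppE.
set m := inf _ in mGp *.
have adm := trunc_admissible oOm cp dp bOm hH1 mGp.
pose c := mobility xi p mu0 p0 beta.
have c0 x : 0 < c x by exact: mobility_gt0.
(* [s] is the dissipation in the weak balance; [q] is its elliptic lower bound, with [k1] in place
   of [K], which makes it continuous on [Om]. *)
pose q x := flat 2 (m - p x) * c x * k1 * dotv (grad p x) (grad p x).
pose s x := flat 2 (m - p x) * c x * dotv (grad p x) (mulmxv (K x) (grad p x)).
have f2_ge0 t : 0 <= flat 2 t :> R by have /andP[] := flat2_bound t.
have q0 x : 0 <= q x.
  by rewrite /q !mulr_ge0// ?(ltW (c0 x)) ?dotv_ge0// ltW.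
have qs x : Om x -> q x <= s x.
  move=> Omx; rewrite /q /s -mulrA ler_wpM2l ?mulr_ge0// ?(ltW (c0 x))//.
  (* Ellipticity is stated for nonzero vectors; for a zero gradient both sides vanish. *)
  have [->|g0] := eqVneq (grad p x) 0; last by have /andP[] := hK x Omx _ g0.
  by rewrite -(scale0r (0 : 'rV[R]_n.+1)) !dotvZl !mul0r mulr0.
have sE x : Om x -> dotv (trunc_grad p m x) (v x) = - s x.
  move=> Omx; rewrite darcy// dotvZl dotvC -scaleNr dotvZl /s dotvC.
  by rewrite /c /mobility; ring.
(* The weak balance tested with the truncation: minus this integral equals a boundary integral of a
   product of two nonpositive factors. *)
have s_le0 : (\int[leb n.+1]_(x in Om) (s x)%:E <= 0)%E.
  have := balance _ _ _ adm.
  under eq_integral => x /set_mem Omx do rewrite sE// EFinN.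
  rewrite integral_ge0N => [E|x Omx]; last by rewrite lee_fin (le_trans (q0 x))// qs.
  rewrite -oppe_ge0 E; apply: integral_ge0 => x Gvx.
  rewrite lee_fin mulr_le0 ?hvn_le0// oppr_le0.
  by have /andP[] := flat01 (m - p x).
have iq : (\int[leb n.+1]_(x in Om) (q x)%:E = 0)%E.
  apply/eqP; rewrite eq_le integral_ge0 ?andbT; last first.
    by move=> x _; rewrite lee_fin.
  apply: le_trans s_le0; apply: ge0_le_integral_nonmeasurable => x Omx.
  by rewrite !lee_fin q0 qs.
have cq x : Om x -> {for x, continuous q}.
  move=> Omx.
  have cc : {for x, continuous c}.
    apply: continuous_mobility => //; last exact: cpOm.
    exact/differentiable_continuous/hxi.
  have cf := @continuous_trunc_coef _ _ Om p m oOm cp 2 x Omx.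
  have cd : {for x, continuous (fun y => dotv (grad p y) (grad p y))}.
    have -> : (fun y => dotv (grad p y) (grad p y)) =
        (fun y => \sum_(i < n.+1) partial i p y * partial i p y).
      by apply/funext => y; apply: eq_bigr => i _; rewrite mxE.
    elim: (index_enum _) => [|i r IH].
      have -> : (fun y => \sum_(i <- [::]) partial i p y * partial i p y) = cst 0.
        by apply/funext => y; rewrite big_nil.
      exact: (@cst_continuous 'rV[R]_n.+1 R 0 x).
    have -> : (fun y => \sum_(j <- i :: r) partial j p y * partial j p y) =
        (fun y => partial i p y * partial i p y +
                  \sum_(j <- r) partial j p y * partial j p y).
      by apply/funext => y; rewrite big_cons.
    have [_ cdp] := dp x Omx i.
    exact: (continuousD (continuousM cdp cdp) IH).
  have ck := @cst_continuous 'rV[R]_n.+1 R k1 x.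
  exact: (continuousM (continuousM (continuousM cf cc) ck) cd).
have q_eq0 := continuous_ge0_integral_eq0 oOm cq (fun x _ => q0 x) iq.
(* Where [p x < m], all factors of [q x] other than the squared gradient are positive. *)
have grad_eq0 x : Om x -> p x < m -> grad p x = 0.
  move=> Omx pxm; apply: dotv_eq0; have /eqP := q_eq0 x Omx.
  rewrite /q !mulf_eq0 (gt_eqF hk1) (gt_eqF (c0 x)) gt_eqF ?flat_gt0 ?subr_gt0//.
  by move=> /eqP.
have lc x : Om x -> p x < m -> \forall y \near x, p y = p x.
  move=> Omx pxm.
  have oU : open (Om `&` [set y | p y < m]).
    rewrite openE => y [Omy pym]; apply: filterI; first exact: open_nbhs_nbhs.
    have oL : open [set r : R | r < m] by exact: open_lt.
    by apply: (cpOm y Omy [set r | r < m]); exact: open_nbhs_nbhs.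
  have [e e0 eU] := open_obox_nbhs oU (conj Omx pxm).
  apply/nbhs_ballP; exists e => // y /(rV_ballP _ _ e0).
  apply: (partial_eq0_box e0) => z /eU[Omz pzm] i.
  have [dpz _] := dp z Omz i.
  have gz : partial i p z = 0.
    by have /rowP/(_ i) := grad_eq0 z Omz pzm; rewrite !mxE.
  by rewrite -gz; exact: derivableP.
(* The bound is closed, so it extends from [Om] to the closure by continuity. *)
suff mOm x : Om x -> [set r : R | m <= r] (p x).
  have cL : closed [set r : R | m <= r] by exact: closed_ge.
  exact: (closure_within_closed cp cL mOm).
move=> Omx; rewrite /= leNgt; apply/negP => pxm.
have pc := connected_locally_constant_below oOm kOm cpOm lc Omx pxm.
(* At a point of [Gp] the constant value, carried to the closure, would lie below [m]. *)
have [y Gpy] := hGp.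
have [cly _] : boundary Om y by rewrite -hGU; left.
have : p y = p x.
  have cE : closed [set r : R | r = p x] by exact: closed_eq.
  exact: (closure_within_closed cp cE pc).
by move=> pyx; have := mGp y Gpy; rewrite pyx leNgt pxm.
Qed.
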